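(* Consider the two Markov jump linear systems driven by the same Markov chain $$\text{(S1)}\quad x_1(k+1)=A_1(\vartheta(k))x_1(k)+B_1(\vartheta(k))v_1(k),\quad z_1(k)=C_1(\vartheta(k))x_1(k),$$ $$\text{(S2)}\quad x_2(k+1)=A_2(\vartheta(k))x_2(k)+B_2(\vartheta(k))v_2(k),\quad z_2(k)=C_2(\vartheta(k))x_2(k)+D_2(\vartheta(k))v_2(k),$$ $k\in\mathbb{N}$. Suppose that (i) (S1) and (S2) are internally stable, and (ii) their input-to-output operators $\mathfrak{L}_1,\mathfrak{L}_2$ on $l^2(\mathbb{N};\mathbb{R}^r)$ satisfy $\|\mathfrak{L}_1\|_\infty\|\mathfrak{L}_2\|_\infty<1$. Then the interconnection obtained by setting $v_2=z_1$ and $v_1=z_2$, namely $$\hat{x}(k+1)=\hat{A}(\vartheta(k))\hat{x}(k),\qquad \hat{A}(\ell)=\begin{bmatrix}A_{1}(\ell)+B_{1}(\ell)D_{2}(\ell)C_{1}(\ell) & B_{1}(\ell)C_{2}(\ell)\\ B_{2}(\ell)C_{1}(\ell) & A_{2}(\ell)\end{bmatrix},\qquad \hat x(k)=\begin{bmatrix} x_1(k) \\ x_2(k) \end{bmatrix},$$ is exponentially mean-square stable.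
   Context: $\Theta$ is a Borel subset of a separable complete metric space, $\mathcal{B}(\Theta)$ its Borel $\sigma$-algebra, $\mu$ a $\sigma$-finite measure on it; all relations between functions on $\Theta$ hold $\mu$-a.e. Matrices carry the spectral norm. $\mathcal{H}^{n\times m}_{\infty}$: measurable $P:\Theta\to\mathbb{R}^{n\times m}$ with $\operatorname{ess\,sup}_\ell\|P(\ell)\|<\infty$. Markov chain: $\{\vartheta(k)\}_{k\in\mathbb{N}}$ takes values in $\Theta$, with initial distribution having density $\nu_0$ with respect to $\mu$, and stochastic kernel $\mathbb{G}(\ell,\Lambda)=\int_\Lambda g(\ell,t)\mu(dt)$. Standing assumptions: $\nu_0(\ell)>0$ $\mu$-a.e. and $\int_\Theta g(t,\ell)\mu(dt)>0$ $\mu$-a.e. $\mathfrak{F}_k=\sigma(\vartheta(0),\dots,\vartheta(k))$, $\vartheta_0=\vartheta(0)$. Coefficients: $A_i\in\mathcal{H}^{n\times n}_\infty$, $B_i\in\mathcal{H}^{n\times r}_\infty$, $C_i\in\mathcal{H}^{r\times n}_\infty$ ($i=1,2$), $D_2\in\mathcal{H}^{r\times r}_\infty$; initial states are deterministic. An autonomous system $x(k+1)=A(\vartheta(k))x(k)$ is exponentially mean-square stable (EMSS) if there are $\beta>0$, $\alpha\in(0,1)$ such that for any initial conditions $(x_0,\vartheta_0)$, $\mathbf{E}\{\|x(k)\|^2\}\le\beta\alpha^k\|x_0\|^2$ for all $k\in\mathbb{N}$. A system with input and output is internally stable if its autonomous part (zero input) is EMSS. $l^2(\mathbb{N};\mathbb{R}^r)$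 is the Hilbert space of random sequences $v$ with $v(k)$ $\mathbb{R}^r$-valued and $\mathfrak{F}_k$-measurable and $\|v\|^2=\sum_{k}\mathbf{E}\|v(k)\|^2<\infty$. For an internally stable system, the input-to-output operator $\mathfrak{L}$ maps an input $v\in l^2(\mathbb{N};\mathbb{R}^r)$ to the output with zero initial state, and $\|\mathfrak{L}\|_\infty=\inf\{\sqrt\gamma:\gamma>0,\ \|\mathfrak{L}(v)\|^2-\gamma\|v\|^2<0 \text{ for any }\vartheta_0\text{ and any nonzero } v\in l^2(\mathbb{N};\mathbb{R}^r)\}$. *)

(* Defs.v *)
From HB Require Import structures.
From mathcomp Require Import all_boot all_order all_algebra.
From mathcomp Require Import all_classical all_reals all_analysis.
From mathcomp Require Import ess_sup_inf.
Import Order.TTheory GRing.Theory Num.Theory.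
Import numFieldNormedType.Exports.

Set Implicit Arguments.
Unset Strict Implicit.
Unset Printing Implicit Defensive.

Local Open Scope classical_set_scope.
Local Open Scope ring_scope.
Local Open Scope ereal_scope.

#[short(type="completeMetricType")]
HB.structure Definition CompleteMetric (K : numDomainType) :=
  { M of Metric K M & CompletePseudoMetric K M }.

Definition separable_space (S : topologicalType) : Prop :=
  exists2 D : set S, countable D & dense D.

Definition borel_set (S : topologicalType) (X : set S) : Prop :=
  <<s [set U : set S | open U] >> X.

(* The subspace X of S as a type. The point x0 of X is needed only because
   measurable types of the library are pointed; X carries a probability
   measure in all uses below, so that it is nonempty. *)
Definition subspace_type (S : topologicalType) (X : set S) (x0 : X) : Type := X.

HB.instance Definition _ (S : topologicalType) (X : set S) (x0 : X) :=
  Topological.copy (subspace_type x0) X.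
HB.instance Definition _ (S : topologicalType) (X : set S) (x0 : X) :=
  isPointed.Build (subspace_type x0) x0.

Definition borel_subspace (S : topologicalType) (X : set S) (x0 : X) :=
  g_sigma_algebraType [set U : set (subspace_type x0) | open U].

HB.instance Definition _ (S : topologicalType) (X : set S) (x0 : X) :=
  Measurable.on (borel_subspace x0).

(* The library norm on matrices is the maximum norm, hence these two. *)
Definition euclid_norm (R : realType) n (x : 'cV[R]_n) : R :=
  Num.sqrt (\sum_(i < n) x i ord0 ^+ 2)%R.

Definition spectral_norm (R : realType) n m (M : 'M[R]_(n, m)) : R :=
  sup [set euclid_norm (M *m x)%R | x in [set x | (euclid_norm x <= 1)%R]].

(* Measurability of a matrix-valued function is measurability of its entries. *)
Definition Hinfty d (T : measurableType d) (R : realType)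
    (mu : {measure set T -> \bar R}) n m (M : T -> 'M[R]_(n, m)) : Prop :=
  (forall i j, measurable_fun [set: T] (fun l => M l i j)) /\
  ess_sup mu (fun l => (spectral_norm (M l))%:E) < +oo.

Definition has_density d (T : measurableType d) (R : realType)
    (mu : {measure set T -> \bar R}) (G : R.-pker T ~> T) (g : T -> T -> R) :
    Prop :=
  [/\ measurable_fun [set: T * T] (fun p : T * T => g p.1 p.2),
      forall l t, (0 <= g l t)%R &
      forall l (L : set T), measurable L ->
        G l L = \int[mu]_(t in L) (g l t)%:E].

(* Generators of the natural filtration: F_k is <<s past theta k >>. *)
Definition past d (T : measurableType d) (W : Type) (theta : nat -> W -> T)
    (k : nat) : set (set W) :=
  \bigcup_(i in [set i | (i <= k)%N])
    preimage_set_system [set: W] (theta i) measurable.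

(* theta is, on the probability space (W, P), a Markov chain with transition
   kernel G whose initial law has an almost everywhere positive density nu0
   with respect to mu. The last clause says that G (theta k) L is a version
   of the conditional probability P(theta k.+1 \in L | F_k). *)
Definition markov_chain d (T : measurableType d) (R : realType)
    (mu : {measure set T -> \bar R}) (G : R.-pker T ~> T)
    d' (W : measurableType d') (P : probability W R) (nu0 : T -> R)
    (theta : nat -> W -> T) : Prop :=
  [/\ (forall k, measurable_fun [set: W] (theta k)),
      measurable_fun [set: T] nu0,
      {ae mu, forall l, (0 < nu0 l)%R},
      (forall L : set T, measurable L ->
         P (theta 0%N @^-1` L) = \int[mu]_(l in L) (nu0 l)%:E) &
      (forall k (E : set W) (L : set T),
         <<s past theta k >> E -> measurable L ->
         P (E `&` theta k.+1 @^-1` L) = \int[P]_(w in E) G (theta k w) L)].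

(* Coefficients of x(k+1) = A x(k) + B v(k), z(k) = C x(k) + D v(k), all
   evaluated at theta(k). *)
Record mjls (T : Type) (R : realType) (n m p : nat) := Mjls {
  sysA : T -> 'M[R]_(n, n);
  sysB : T -> 'M[R]_(n, m);
  sysC : T -> 'M[R]_(p, n);
  sysD : T -> 'M[R]_(p, m) }.

Fixpoint state T (R : realType) n m p (S : mjls T R n m p) W
    (theta : nat -> W -> T) (x0 : 'cV[R]_n) (v : nat -> W -> 'cV[R]_m)
    (k : nat) (w : W) {struct k} : 'cV[R]_n :=
  if k is k'.+1 then
    (sysA S (theta k' w) *m state S theta x0 v k' w
     + sysB S (theta k' w) *m v k' w)%R
  else x0.

Definition io_operator T (R : realType) n m p (S : mjls T R n m p) W
    (theta : nat -> W -> T) (v : nat -> W -> 'cV[R]_m) (k : nat) (w : W) :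
    'cV[R]_p :=
  (sysC S (theta k w) *m state S theta 0 v k w
   + sysD S (theta k w) *m v k w)%R.

Fixpoint auto_state T (R : realType) n (A : T -> 'M[R]_n) W
    (theta : nat -> W -> T) (x0 : 'cV[R]_n) (k : nat) (w : W) {struct k} :
    'cV[R]_n :=
  if k is k'.+1 then (A (theta k' w) *m auto_state A theta x0 k' w)%R else x0.

(* The initial conditions are the deterministic x0 and the law of theta(0):
   beta and alpha depend only on A, mu and G, while the probability space,
   the initial density and the chain are arbitrary. *)
Definition EMSS d (T : measurableType d) (R : realType)
    (mu : {measure set T -> \bar R}) (G : R.-pker T ~> T) n
    (A : T -> 'M[R]_n) : Prop :=
  exists beta alpha : R,
    [/\ (0 < beta)%R, (0 < alpha < 1)%R &
        forall d' (W : measurableType d') (P : probability W R)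
               (nu0 : T -> R) (theta : nat -> W -> T),
          markov_chain mu G P nu0 theta ->
          forall (x0 : 'cV[R]_n) (k : nat),
            'E_P[fun w => (euclid_norm (auto_state A theta x0 k w) ^+ 2)%R]
            <= (beta * alpha ^+ k * euclid_norm x0 ^+ 2)%:E].

Definition internally_stable d (T : measurableType d) (R : realType)
    (mu : {measure set T -> \bar R}) (G : R.-pker T ~> T) n m p
    (S : mjls T R n m p) : Prop :=
  EMSS mu G (sysA S).

Definition l2_normsq d' (W : measurableType d') (R : realType)
    (P : probability W R) r (v : nat -> W -> 'cV[R]_r) : \bar R :=
  \sum_(0 <= k <oo) 'E_P[fun w => (euclid_norm (v k w) ^+ 2)%R].

Definition in_l2 d (T : measurableType d) d' (W : measurableType d')
    (R : realType) (P : probability W R) (theta : nat -> W -> T) r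
    (v : nat -> W -> 'cV[R]_r) : Prop :=
  (forall k i,
     @measurable_fun _ _ (g_sigma_algebraType (past theta k)) R setT
       (fun w => v k w i ord0)) /\
  l2_normsq P v < +oo.

(* Zero in l^2 means almost surely zero at every time. *)
Definition l2_nonzero d' (W : measurableType d') (R : realType)
    (P : probability W R) r (v : nat -> W -> 'cV[R]_r) : Prop :=
  ~ (forall k, {ae P, forall w, v k w = 0%R}).

(* As in EMSS, "any theta_0" ranges over all realizations of the chain. The
   infimum is taken in \bar R, so that it is +oo (not 0) on the empty set. *)
Definition io_norm d (T : measurableType d) (R : realType)
    (mu : {measure set T -> \bar R}) (G : R.-pker T ~> T) n m p
    (S : mjls T R n m p) : \bar R :=
  ereal_inf [set (Num.sqrt gamma)%:E | gamma in [set gamma : R |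
    (0 < gamma)%R /\
    forall d' (W : measurableType d') (P : probability W R)
           (nu0 : T -> R) (theta : nat -> W -> T),
      markov_chain mu G P nu0 theta ->
      forall v : nat -> W -> 'cV[R]_m,
        in_l2 P theta v -> l2_nonzero P v ->
        l2_normsq P (io_operator S theta v) - gamma%:E * l2_normsq P v < 0]].

(* Main.v *)
Require Import Defs.
From HB Require Import structures.
From mathcomp Require Import all_boot all_order all_algebra.
From mathcomp Require Import all_classical all_reals all_analysis.
From mathcomp Require Import measurable_realfun.
From mathcomp Require Import ring lra.
Import Order.TTheory GRing.Theory Num.Theory.
Import numFieldNormedType.Exports.
Local Open Scope classical_set_scope.
Local Open Scope ring_scope.

Set Implicit Arguments.
Unset Strict Implicit.
Unset Printing Implicit Defensive.

(** The two outputs z1 and z2 of the loop are estimated by the classical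
small-gain argument on truncations to [0, N), which are finite in mean square
because the coefficients are essentially bounded; letting N grow bounds
sum_k E|x(k)|^2 by C|x(0)|^2. A tail-sum argument then gives exponential decay,
provided the same bound holds when the system is restarted at time k from the
random state x(k).

Stability hypotheses only speak of deterministic initial states and of chains
whose initial density is positive almost everywhere. They are transferred to a
random state measurable at time j by changing the probability: under a tilt
(P + s P|_E) / (1 + s P(E)) with E in F_j, the chain seen from time j + 1 on is
again an admissible realization, because the law of every theta(k) is equivalent
to mu. Letting s tend to infinity yields the estimate on every E in F_j, hence
for every weight measurable at time j. *)

(** * Squared Frobenius norm *)

(** Stability and gain are hypotheses about every probability space that carries an admissible
    chain, with constants chosen before the space. A restart can therefore keep the sample space and
    all random variables and replace only the probability. It takes place at time j + 1 for events
    of F_j because x(j + 1) is a function of theta(0), ..., theta(j), while the law of theta(j + 1)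
    is an average of the densities g(theta(j), .) and so has a density however theta(j) has been
    reweighted. The operator gains concern zero initial states, whereas the loop starts from x(0).
    Superposition adds the free response of each system, at the price of a factor 1 + e on each
    gain; the strict inequality between the norms leaves room for these two factors. *)

Lemma cauchy_schwarz_sum (R : realType) (I : finType) (a b : I -> R) :
  (\sum_i a i * b i) ^+ 2 <= (\sum_i a i ^+ 2) * (\sum_i b i ^+ 2).
Proof.
rewrite -subr_ge0; set D := (X in 0 <= X).
(* Lagrange's identity. *)
suff -> : D = 2^-1 * \sum_i \sum_j (a i * b j - a j * b i) ^+ 2.
  by rewrite mulr_ge0// sumr_ge0// => i _; rewrite sumr_ge0// => j _; exact: sqr_ge0.
have E : \sum_i \sum_j (a i * b j - a j * b i) ^+ 2 =
   \sum_i \sum_j (a i ^+ 2 * b j ^+ 2 + b i ^+ 2 * a j ^+ 2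
     - 2 * (a i * b i) * (a j * b j)).
  by apply: eq_bigr => i _; apply: eq_bigr => j _; ring.
rewrite E; under eq_bigr do rewrite sumrB big_split/= -!mulr_sumr.
rewrite sumrB big_split/= -!mulr_suml -mulr_sumr /D; by field.
Qed.

(** Cauchy-Schwarz for the factorization of [y j] as [Num.sqrt (p j)] times
    [y j / Num.sqrt (p j)]. *)
Lemma sqr_sum_le_weighted (R : realType) k (p y : 'I_k -> R) :
  (forall j, 0 < p j) ->
  (\sum_j y j) ^+ 2 <= (\sum_j p j) * (\sum_j (p j)^-1 * y j ^+ 2).
Proof.
move=> p0.
have pE j : p j = Num.sqrt (p j) ^+ 2 by rewrite sqr_sqrtr// ltW.
have sp j : Num.sqrt (p j) != 0 by rewrite gt_eqF// sqrtr_gt0.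
rewrite [leLHS](_ : _ =
  (\sum_j Num.sqrt (p j) * ((Num.sqrt (p j))^-1 * y j)) ^+ 2); last first.
  by congr (_ ^+ 2); apply: eq_bigr => j _; rewrite mulVKf.
apply: le_trans; first exact: cauchy_schwarz_sum.
rewrite le_eqVlt; apply/orP; left; apply/eqP; congr (_ * _).
  by apply: eq_bigr => j _; rewrite -pE.
by apply: eq_bigr => j _; rewrite exprMn exprVn -pE.
Qed.

Section fro.
Context {R : realType}.

(** A polynomial in the entries, so that measurability is immediate. It is the squared Euclidean
    norm on columns, where gains are measured; for coefficients it replaces the spectral norm, at
    the cost of constants that do not matter. *)
Definition fro2 n m (M : 'M[R]_(n, m)) : R := \sum_i \sum_j M i j ^+ 2.

Lemma fro2_ge0 n m (M : 'M[R]_(n, m)) : 0 <= fro2 M.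
Proof. by apply: sumr_ge0 => i _; apply: sumr_ge0 => j _; exact: sqr_ge0. Qed.

Lemma fro2_0 n m : fro2 (0 : 'M[R]_(n, m)) = 0.
Proof.
by rewrite /fro2 big1// => i _; rewrite big1// => j _; rewrite mxE expr0n.
Qed.

Lemma euclid_normE n (x : 'cV[R]_n) : euclid_norm x ^+ 2 = fro2 x.
Proof.
rewrite /euclid_norm sqr_sqrtr ?sumr_ge0// => [|i _]; last exact: sqr_ge0.
by apply: eq_bigr => i _; rewrite big_ord1.
Qed.

Lemma fro2M n m p (A : 'M[R]_(n, m)) (B : 'M[R]_(m, p)) :
  fro2 (A *m B) <= fro2 A * fro2 B.
Proof.
rewrite /fro2 mulr_suml; apply: ler_sum => i _.
rewrite exchange_big/= mulr_sumr; apply: ler_sum => j _.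
by rewrite mxE cauchy_schwarz_sum.
Qed.

(** Young's inequality. A small [e] charges [B] hardly more than once, which is what keeps the loop
    gain below 1 when free responses are added. *)
Lemma fro2D_le n m (e : R) (A B : 'M[R]_(n, m)) : 0 < e ->
  fro2 (A + B) <= (1 + e^-1) * fro2 A + (1 + e) * fro2 B.
Proof.
move=> e0; rewrite /fro2 !mulr_sumr -big_split; apply: ler_sum => i _ /=.
rewrite !mulr_sumr -big_split; apply: ler_sum => j _ /=; rewrite mxE.
rewrite -subr_ge0 [leRHS](_ : _ = e * (e^-1 * A i j - B i j) ^+ 2).
  by rewrite mulr_ge0 ?sqr_ge0 ?ltW.
by field; rewrite gt_eqF.
Qed.

Lemma fro2D n m (A B : 'M[R]_(n, m)) :
  fro2 (A + B) <= 2 * fro2 A + 2 * fro2 B.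
Proof.
apply: (le_trans (fro2D_le _ _ (@ltr01 R))).
by rewrite invr1.
Qed.

Lemma fro2_sum_weighted n m k (p : 'I_k -> R) (y : 'I_k -> 'M[R]_(n, m)) :
  (forall j, 0 < p j) ->
  fro2 (\sum_j y j) <= (\sum_j p j) * \sum_j (p j)^-1 * fro2 (y j).
Proof.
move=> p0; rewrite {1}/fro2.
apply: (@le_trans _ _ (\sum_a \sum_b (\sum_j p j) * \sum_j (p j)^-1 * y j a b ^+ 2)).
  apply: ler_sum => a _; apply: ler_sum => b _; rewrite summxE.
  exact: sqr_sum_le_weighted.
rewrite le_eqVlt; apply/orP; left; apply/eqP.
under eq_bigr do rewrite -mulr_sumr exchange_big/=.
rewrite -mulr_sumr exchange_big/=; congr (_ * _).
apply: eq_bigr => j _; rewrite /fro2 mulr_sumr.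
by apply: eq_bigr => a _; rewrite mulr_sumr.
Qed.

Lemma fro2_block n1 n2 m1 m2 (A : 'M[R]_(n1, m1)) (B : 'M[R]_(n1, m2))
    (C : 'M[R]_(n2, m1)) (D : 'M[R]_(n2, m2)) :
  fro2 (block_mx A B C D) = fro2 A + fro2 B + fro2 C + fro2 D.
Proof.
rewrite /fro2 big_split_ord/= -addrA; congr (_ + _).
  rewrite -big_split; apply: eq_bigr => i _; rewrite big_split_ord/=.
  congr (_ + _); apply: eq_bigr => j _; first by rewrite block_mxEul.
  by rewrite block_mxEur.
rewrite -big_split; apply: eq_bigr => i _; rewrite big_split_ord/=.
congr (_ + _); apply: eq_bigr => j _; first by rewrite block_mxEdl.
by rewrite block_mxEdr.
Qed.

Lemma fro2_submx n1 n2 (x : 'cV[R]_(n1 + n2)) :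
  fro2 x = fro2 (usubmx x) + fro2 (dsubmx x).
Proof.
rewrite /fro2 big_split_ord/=.
by congr (_ + _); apply: eq_bigr => i _; apply: eq_bigr => j _; rewrite mxE.
Qed.

(** Reduces bounds on a matrix to bounds on its images of basis vectors, both for the spectral norm
    and for random transition matrices. *)
Lemma fro2_colM n m (A : 'M[R]_(n, m)) : fro2 A = \sum_j fro2 (A *m delta_mx j (@ord0 0)).
Proof.
rewrite /fro2 exchange_big/=; apply: eq_bigr => j _; apply: eq_bigr => i _.
rewrite big_ord1 mxE (bigD1 j)//= big1 ?addr0; first by rewrite mxE !eqxx mulr1.
by move=> k kj; rewrite mxE (negbTE kj) mulr0.
Qed.

Lemma fro2_delta m (j : 'I_m) : fro2 (delta_mx j (@ord0 0)) = 1.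
Proof.
rewrite /fro2 (bigD1 j)//= big_ord1 mxE !eqxx expr1n big1 ?addr0// => i ij.
by rewrite big_ord1 mxE (negbTE ij) expr0n.
Qed.

Lemma euclid_norm_le_spectral n m (M : 'M[R]_(n, m)) (x : 'cV[R]_m) :
  fro2 x <= 1 -> euclid_norm (M *m x) <= spectral_norm M.
Proof.
move=> x1; apply: ub_le_sup.
  (* The real [sup] is an upper bound only of a bounded set; the Frobenius norm bounds this one. *)
  exists (Num.sqrt (fro2 M)) => _ [y /= y1 <-].
  rewrite -[leLHS]ger0_norm ?sqrtr_ge0// -sqrtr_sqr ler_wsqrtr//.
  rewrite euclid_normE (le_trans (fro2M _ _))// ler_piMr ?fro2_ge0//.
  by rewrite -euclid_normE expr_le1 ?sqrtr_ge0.
by exists x => //=; rewrite -(@expr_le1 _ 2)// ?sqrtr_ge0// euclid_normE.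
Qed.

Lemma spectral_norm_ge0 n m (M : 'M[R]_(n, m)) : 0 <= spectral_norm M.
Proof.
apply: (@le_trans _ _ (euclid_norm (M *m 0))); first exact: sqrtr_ge0.
by apply: euclid_norm_le_spectral; rewrite fro2_0.
Qed.

Lemma fro2_le_spectral n m (M : 'M[R]_(n, m)) :
  fro2 M <= m%:R * spectral_norm M ^+ 2.
Proof.
rewrite fro2_colM [leRHS](_ : _ = \sum_(j < m) spectral_norm M ^+ 2); last first.
  by rewrite sumr_const card_ord mulr_natl.
apply: ler_sum => j _.
rewrite -euclid_normE lerXn2r ?nnegrE ?sqrtr_ge0 ?spectral_norm_ge0//.
by rewrite euclid_norm_le_spectral ?fro2_delta.
Qed.

End fro.

(** * Measurable and essentially bounded coefficients *)

Definition essbounded d (T : measurableType d) (R : realType)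
    (mu : {measure set T -> \bar R}) n m (M : T -> 'M[R]_(n, m)) : Prop :=
  exists c : R, 0 < c /\ {ae mu, forall l, fro2 (M l) <= c}.

Definition mx_measurable d (T : measurableType d) (R : realType) n m
    (M : T -> 'M[R]_(n, m)) : Prop :=
  forall i j, measurable_fun [set: T] (fun l => M l i j).

Lemma Hinfty_essbounded d (T : measurableType d) (R : realType)
    (mu : {measure set T -> \bar R}) n m (M : T -> 'M[R]_(n, m)) :
  Hinfty mu M -> mx_measurable M /\ essbounded mu M.
Proof.
move=> [mM Moo]; split=> //.
have [c Mc] : exists c : R, {ae mu, forall l, spectral_norm (M l) <= c}.
  have [y yS] := ereal_inf_lt Moo.
  case: y yS => [y||]// yS _; first by exists y; apply: filterS yS => l; rewrite lee_fin.
  (* An essential upper bound [-oo] is possible only for the zero measure, where any real bound will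
     do. *)
  by exists 0; apply: filterS yS => l; rewrite leeNy_eq.
exists (m%:R * c ^+ 2 + 1); split; first by rewrite ltr_wpDl// mulr_ge0 ?sqr_ge0.
apply: filterS Mc => l Mc; apply: (le_trans (fro2_le_spectral _)).
rewrite ler_wpDr// ler_wpM2l// lerXn2r ?nnegrE ?spectral_norm_ge0//.
exact: le_trans (spectral_norm_ge0 _) Mc.
Qed.

Section mx_measurable.
Context d (T : measurableType d) (R : realType).

Lemma mx_measurableM n m p (A : T -> 'M[R]_(n, m)) (B : T -> 'M[R]_(m, p)) :
  mx_measurable A -> mx_measurable B -> mx_measurable (fun l => A l *m B l).
Proof.
move=> mA mB i j; under eq_fun do rewrite mxE.
by apply: measurable_sum => k; exact: measurable_funM.
Qed.

Lemma mx_measurableD n m (A B : T -> 'M[R]_(n, m)) :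
  mx_measurable A -> mx_measurable B -> mx_measurable (fun l => A l + B l).
Proof.
by move=> mA mB i j; under eq_fun do rewrite mxE; exact: measurable_funD.
Qed.

Lemma mx_measurable_cst n m (A : 'M[R]_(n, m)) : mx_measurable (fun _ : T => A).
Proof. by move=> i j; exact: measurable_cst. Qed.

Lemma mx_measurable_usubmx n1 n2 m (A : T -> 'M[R]_(n1 + n2, m)) :
  mx_measurable A -> mx_measurable (fun l => usubmx (A l)).
Proof. by move=> mA i j; under eq_fun do rewrite mxE; exact: mA. Qed.

Lemma mx_measurable_dsubmx n1 n2 m (A : T -> 'M[R]_(n1 + n2, m)) :
  mx_measurable A -> mx_measurable (fun l => dsubmx (A l)).
Proof. by move=> mA i j; under eq_fun do rewrite mxE; exact: mA. Qed.

Lemma mx_measurable_block n1 n2 m1 m2 (A : T -> 'M[R]_(n1, m1))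
    (B : T -> 'M[R]_(n1, m2)) (C : T -> 'M[R]_(n2, m1)) (D : T -> 'M[R]_(n2, m2)) :
  mx_measurable A -> mx_measurable B -> mx_measurable C -> mx_measurable D ->
  mx_measurable (fun l => block_mx (A l) (B l) (C l) (D l)).
Proof.
move=> mA mB mC mD i j; rewrite /block_mx.
by case: (split_ordP i) => i' ->; case: (split_ordP j) => j' ->;
  [under eq_fun do rewrite col_mxEu row_mxEl|under eq_fun do rewrite col_mxEu row_mxEr
  |under eq_fun do rewrite col_mxEd row_mxEl|under eq_fun do rewrite col_mxEd row_mxEr];
  [exact: mA|exact: mB|exact: mC|exact: mD].
Qed.

Lemma measurable_fro2 n m (A : T -> 'M[R]_(n, m)) :
  mx_measurable A -> measurable_fun [set: T] (fun l => fro2 (A l)).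
Proof.
move=> mA; apply: measurable_sum => i; apply: measurable_sum => j.
exact: measurable_funX.
Qed.

End mx_measurable.

Lemma mx_measurable_comp d d' (T : measurableType d) (W : measurableType d')
    (R : realType) n m (A : T -> 'M[R]_(n, m)) (f : W -> T) :
  mx_measurable A -> measurable_fun [set: W] f -> mx_measurable (fun w => A (f w)).
Proof.
move=> mA mf i j.
exact: (measurableT_comp (f := fun l => A l i j) (mA i j) mf).
Qed.

Section essbounded.
Context d (T : measurableType d) (R : realType) (mu : {measure set T -> \bar R}).

Lemma essboundedM n m p (A : T -> 'M[R]_(n, m)) (B : T -> 'M[R]_(m, p)) :
  essbounded mu A -> essbounded mu B -> essbounded mu (fun l => A l *m B l).
Proof.
move=> [a [a0 Aa]] [b [b0 Bb]]; exists (a * b); split; first exact: mulr_gt0.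
apply: filterS2 Aa Bb => l Aa Bb; apply: (le_trans (fro2M _ _)).
by apply: ler_pM => //; exact: fro2_ge0.
Qed.

Lemma essboundedD n m (A B : T -> 'M[R]_(n, m)) :
  essbounded mu A -> essbounded mu B -> essbounded mu (fun l => A l + B l).
Proof.
move=> [a [a0 Aa]] [b [b0 Bb]]; exists (2 * a + 2 * b); split; first lra.
apply: filterS2 Aa Bb => l Aa Bb; apply: (le_trans (fro2D _ _)); lra.
Qed.

Lemma essbounded_block n1 n2 m1 m2 (A : T -> 'M[R]_(n1, m1))
    (B : T -> 'M[R]_(n1, m2)) (C : T -> 'M[R]_(n2, m1)) (D : T -> 'M[R]_(n2, m2)) :
  essbounded mu A -> essbounded mu B -> essbounded mu C -> essbounded mu D ->
  essbounded mu (fun l => block_mx (A l) (B l) (C l) (D l)).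
Proof.
move=> [a [a0 Aa]] [b [b0 Bb]] [c [c0 Cc]] [e [e0 De]].
exists (a + b + c + e); split; first by rewrite !addr_gt0.
have ABC : {ae mu, forall l, fro2 (A l) + fro2 (B l) + fro2 (C l) <= a + b + c}.
  by apply: filterS3 Aa Bb Cc => l ? ? ?; rewrite !lerD.
by apply: filterS2 ABC De => l ? ?; rewrite fro2_block lerD.
Qed.

End essbounded.

(** * Laws of the chain and its shifts *)

Definition shifted (X : Type) (s : nat) (u : nat -> X) : nat -> X := fun k => u (s + k)%N.

Section filtration.
Context d (T : measurableType d) (W : Type) (theta : nat -> W -> T).

Lemma past_le j k : (j <= k)%N -> <<s past theta j >> `<=` <<s past theta k >>.
Proof.
move=> jk; apply: sub_smallest2r; first exact: smallest_sigma_algebra.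
by move=> X [i /= ij iX]; exists i => //=; exact: leq_trans ij jk.
Qed.

Lemma past_preimage i k (L : set T) : (i <= k)%N -> measurable L ->
  <<s past theta k >> (theta i @^-1` L).
Proof.
move=> ik mL; apply: sub_gen_smallest; exists i => //=; exists L => //.
by rewrite setTI.
Qed.

Lemma past_shift s i : <<s past (shifted s theta) i >> `<=` <<s past theta (s + i) >>.
Proof.
apply: sub_smallest2r; first exact: smallest_sigma_algebra.
by move=> X [j /= ji jX]; exists (s + j)%N => //=; rewrite leq_add2l.
Qed.

End filtration.

Lemma past_measurable d (T : measurableType d) d' (W : measurableType d')
    (theta : nat -> W -> T) k :
  (forall k, measurable_fun [set: W] (theta k)) ->
  <<s past theta k >> `<=` measurable.
Proof.
move=> mtheta; apply: smallest_sub; first exact: sigma_algebra_measurable.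
by move=> X [i _ [L mL <-]]; exact: mtheta.
Qed.

Section chain.
Context d (T : measurableType d) (R : realType)
  (mu : {sigma_finite_measure set T -> \bar R})
  (G : R.-pker T ~> T) (g : T -> T -> R) (Gg : has_density mu G g).
Context d' (W : measurableType d') (theta : nat -> W -> T)
  (mtheta : forall k, measurable_fun [set: W] (theta k)).

Local Open Scope ereal_scope.

Let mg : measurable_fun [set: T * T] (fun p : T * T => g p.1 p.2).
Proof. by case: Gg. Qed.

Let g0 l t : 0 <= (g l t)%:E.
Proof. by case: Gg => _ h _; rewrite lee_fin h. Qed.

Let mgW k : measurable_fun [set: W * T] (fun p : W * T => (g (theta k p.1) p.2)%:E).
Proof.
apply/measurable_EFinP.
apply: (measurableT_comp (f := fun p : T * T => g p.1 p.2) mg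
  (g := fun p : W * T => (theta k p.1, p.2))).
apply: measurable_fun_pair => //.
exact: (measurableT_comp (mtheta k) measurable_fst).
Qed.

(** The density of [theta k.+1] when its conditional law is [G (theta k w)]. It need be finite only
    almost everywhere, hence the values in [\bar R]. *)
Definition next_density (P : probability W R) k t : \bar R :=
  \int[P]_w (g (theta k w) t)%:E.

Lemma next_density_ge0 P k t : 0 <= next_density P k t.
Proof. exact: integral_ge0. Qed.

Lemma measurable_next_density P k : measurable_fun [set: T] (next_density P k).
Proof.
exact: (measurable_fun_fubini_tonelli_G (m1 := P) _ (mgW k)
  (fun p => g0 (theta k p.1) p.2)).
Qed.

(** Tonelli for [P] and the sigma-finite [mu], with the indicator of [L] moved into the
    integrand. *)
Lemma next_densityE (P : probability W R) k :
  (forall L, measurable L -> P (theta k.+1 @^-1` L) = \int[P]_w G (theta k w) L) ->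
  forall L, measurable L ->
    P (theta k.+1 @^-1` L) = \int[mu]_(t in L) next_density P k t.
Proof.
move=> PG L mL; rewrite PG//.
pose f (p : W * T) : \bar R := (g (theta k p.1) p.2)%:E * (\1_L p.2)%:E.
have mf : measurable_fun [set: W * T] f.
  apply: emeasurable_funM => //; apply/measurable_EFinP.
  exact: (measurableT_comp (measurable_indic mL) measurable_snd).
have f0 p : 0 <= f p by rewrite mule_ge0// lee_fin.
transitivity (\int[P]_w \int[mu]_t f (w, t)).
  apply: eq_integral => w _; case: Gg => _ _ ->//.
  by rewrite integral_mkcond epatch_indic.
rewrite fubini_tonelli// [RHS]integral_mkcond; apply: eq_integral => t _.
rewrite epatch_indic /f/= ge0_integralZr//.
apply: (measurableT_comp (mgW k) (g := fun w => (w, t))).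
exact: pair2_measurable.
Qed.

(** If the average of [g (theta k w) t] vanishes, then [theta k] almost surely avoids the set of [s]
    with [g s t] nonzero. By domination this set is [mu]-null, so the integral of [g s t] in [s]
    vanishes, which is excluded for almost every [t]. *)
Lemma next_density_gt0 (P : probability W R) k :
  {ae mu, forall l, 0 < \int[mu]_t (g t l)%:E} ->
  (forall L, measurable L -> P (theta k @^-1` L) = 0 -> mu L = 0) ->
  {ae mu, forall t, 0 < next_density P k t}.
Proof.
move=> g_gt0 Pmu; apply: filterS g_gt0 => t gt0.
rewrite lt_neqAle next_density_ge0 andbT eq_sym; apply/negP => /eqP nd0.
have mgt : measurable_fun [set: T] (fun s => (g s t)%:E).
  apply/measurable_EFinP.
  apply: (measurableT_comp mg (g := fun s => (s, t))).
  exact: pair2_measurable.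
have mgWt : measurable_fun [set: W] (fun w => (g (theta k w) t)%:E).
  exact: (measurableT_comp mgt (mtheta k)).
pose L := [set s | (g s t)%:E != 0].
have mL : measurable L.
  rewrite (_ : L = [set: T] `&` (fun s => (g s t)%:E) @^-1` (~` [set 0])).
    by apply: mgt => //; apply: measurableC; exact: emeasurable_set1.
  by rewrite setTI; apply/seteqP; split => s /=; move/eqP.
have := Pmu L mL => PL.
have aeP : ae_eq P setT (fun w => (g (theta k w) t)%:E) (cst 0).
  apply/ae_eq_integral_abs => //.
  by under eq_integral do rewrite gee0_abs//.
have PL0 : P (theta k @^-1` L) = 0.
  apply: (measure_negligible (mu := P)).
    by rewrite -[X in measurable X]setTI; exact: mtheta.
  by apply: negligibleS aeP => w /= /eqP gn0 h; apply: gn0; exact: h.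
suff : \int[mu]_s (g s t)%:E = 0 by move=> e; rewrite e ltxx in gt0.
transitivity (\int[mu]_s `|(g s t)%:E|).
  by apply: eq_integral => s _; rewrite gee0_abs.
apply/ae_eq_integral_abs => //.
have := PL PL0; move/(negligibleP mu mL); apply: negligibleS => s /= h.
by apply/negP => /eqP e; apply: h => _; exact: e.
Qed.

(** [markov_chain] asks for a real-valued initial density. Finite total mass makes [nu] finite
    almost everywhere, so [fine] alters it on a null set only. *)
Lemma ge0_measure_fine_density (nu : T -> \bar R) (P : set T -> \bar R) :
  measurable_fun [set: T] nu -> (forall t, 0 <= nu t) -> P setT < +oo ->
  (forall L, measurable L -> P L = \int[mu]_(t in L) nu t) ->
  {ae mu, forall t, 0 < nu t} ->
  [/\ measurable_fun [set: T] (fine \o nu), {ae mu, forall t, (0 < fine (nu t))%R} &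
   forall L, measurable L -> P L = \int[mu]_(t in L) (fine (nu t))%:E].
Proof.
move=> mnu nu0 Poo PE nugt0.
have inu : mu.-integrable setT nu.
  apply/integrableP; split => //; rewrite PE// in Poo.
  by under eq_integral do rewrite gee0_abs//.
have fnu : {ae mu, forall t, nu t \is a fin_num}.
  by have := integrable_ae measurableT inu; apply: filterS => t; apply.
split.
- exact: measurableT_comp.
- by apply: filterS2 fnu nugt0 => t nut nut0; rewrite -lte_fin fineK.
- move=> L mL; rewrite PE//; apply: ge0_ae_eq_integral => //.
  + exact: measurable_funTS.
  + by apply/measurable_EFinP; apply: measurable_funTS; exact: measurableT_comp.
  + by move=> t _; rewrite lee_fin fine_ge0.
  + by apply: filterS fnu => t ft _; rewrite fineK.
Qed.

Variables (P : probability W R) (nu0 : T -> R).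
Hypothesis chainP : markov_chain mu G P nu0 theta.

Lemma chain_step k L : measurable L ->
  P (theta k.+1 @^-1` L) = \int[P]_w G (theta k w) L.
Proof.
move=> mL; case: chainP => _ _ _ _ /(_ k setT L) <-//; first by rewrite setTI.
by have := past_preimage (theta := theta) (leqnn k) (@measurableT _ T).
Qed.

Lemma chain_law_dominated k L : measurable L -> mu L = 0 -> P (theta k @^-1` L) = 0.
Proof.
move=> mL L0; case: k => [|k].
  case: chainP => _ mnu0 _ -> // _; apply: null_set_integral => //.
  by apply/measurable_EFinP; exact: measurable_funTS.
rewrite chain_step//; apply: integral0_eq => w _.
case: Gg => _ _ ->//; apply: null_set_integral => //.
apply/measurable_EFinP; apply: measurable_funTS.
by apply: (measurableT_comp mg (g := fun t => (_, t))); exact: pair1_measurable.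
Qed.

(** Lets the essential bounds on the coefficients be used along trajectories. *)
Lemma chain_ae k (p : T -> Prop) : {ae mu, forall l, p l} ->
  {ae P, forall w, p (theta k w)}.
Proof.
move=> [L [mL L0 pL]]; exists (theta k @^-1` L); split => //.
- by rewrite -[X in measurable X]setTI; exact: mtheta.
- exact: chain_law_dominated.
- by move=> w /= npw; exact: pL.
Qed.

Hypothesis g_gt0 : {ae mu, forall l, 0 < \int[mu]_t (g t l)%:E}.

Lemma density_dominated (nu : T -> \bar R) L : measurable L ->
  measurable_fun [set: T] nu -> {ae mu, forall t, 0 < nu t} ->
  \int[mu]_(t in L) nu t = 0 -> mu L = 0.
Proof.
move=> mL mnu nu_gt0 int0.
have /ae_eq_integral_abs : \int[mu]_(t in L) `|nu t| = 0.
  rewrite -[RHS]int0; apply: ae_eq_integral => //.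
  - by apply: measurableT_comp => //; exact: measurable_funTS.
  - exact: measurable_funTS.
  - by apply: filterS nu_gt0 => t nut _; rewrite gee0_abs// ltW.
move=> /(_ mL (measurable_funTS mnu)) nu_eq0.
apply: (measure_negligible mL).
have : {ae mu, forall t, ~ L t}.
  by apply: filterS2 nu_gt0 nu_eq0 => t nut h Lt; rewrite h// ltxx in nut.
by apply: negligibleS => t Lt /=; apply.
Qed.

(** The positive initial density starts the induction, and [next_density_gt0] propagates positivity
    by one step. *)
Lemma chain_law_dominates k L : measurable L -> P (theta k @^-1` L) = 0 -> mu L = 0.
Proof.
elim: k L => [|k IH] L mL.
  case: chainP => _ mnu0 nu0_gt0 -> // _; apply: density_dominated => //.
  exact/measurable_EFinP.
rewrite (next_densityE (@chain_step k))//; apply: density_dominated => //.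
  exact: measurable_next_density.
exact: next_density_gt0.
Qed.

(** Absolute continuity of [P] with respect to [P'] is enough: a set that [theta j] avoids under
    [P'] is avoided under [P], hence [mu]-null, so the density of [theta j.+1] under [P'] is
    positive. The Markov property is required only from time [j] on, since a change of probability
    by an event of F_j may destroy it earlier. *)
Lemma chain_shift (P' : probability W R) j :
  (forall L, measurable L -> P' L = 0 -> P L = 0) ->
  (forall k (E : set W) (L : set T),
     (j <= k)%N -> <<s past theta k >> E -> measurable L ->
     P' (E `&` theta k.+1 @^-1` L) = \int[P']_(w in E) G (theta k w) L) ->
  exists nu, markov_chain mu G P' nu (shifted j.+1 theta).
Proof.
move=> PP' markov.
have step L : measurable L -> P' (theta j.+1 @^-1` L) = \int[P']_w G (theta j w) L.
  move=> mL; rewrite -markov//; first by rewrite setTI.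
  by have := past_preimage (theta := theta) (leqnn j) (@measurableT _ T).
have P'oo : P' (theta j.+1 @^-1` setT) < +oo.
  by rewrite preimage_setT probability_setT ltry.
have nd_gt0 : {ae mu, forall t, 0 < next_density P' j t}.
  apply: next_density_gt0 => // L mL PL; apply: (@chain_law_dominates j) => //.
  by apply: PP' => //; rewrite -[X in measurable X]setTI; exact: mtheta.
have [mnu nu_gt0 nuE] := ge0_measure_fine_density
  (P := fun L => P' (theta j.+1 @^-1` L)) (measurable_next_density P' j)
  (next_density_ge0 P' j) P'oo (next_densityE step) nd_gt0.
exists (fine \o next_density P' j); split => //.
- by move=> k; exact: mtheta.
- by move=> L mL; rewrite -nuE// /shifted addn0.
- move=> k E L FE mL; rewrite /shifted addnS; apply: markov => //.
    by rewrite addSn ltnW// ltnS leq_addr.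
  exact: past_shift.
Qed.

End chain.

(** * Changes of probability and restarts *)

Section tilt.
Context d (W : measurableType d) (R : realType) (P : probability W R).
Local Open Scope ereal_scope.

Lemma integral_mrestr (E : set W) (mE : measurable E) (X : set W) (f : W -> \bar R) :
  measurable X -> measurable_fun [set: W] f -> (forall w, 0 <= f w) ->
  \int[mrestr P mE]_(w in X) f w = \int[P]_(w in X `&` E) f w.
Proof.
move=> mX mf f0.
rewrite (@ge0_negligible_integral _ _ _ (mrestr P mE) X (~` E))//.
- rewrite setDE setCK; apply: eq_measure_integral => A mA AX.
  by rewrite /= /mrestr setIidl// => w /AX [].
- exact: measurableC.
- exact: measurable_funTS.
- by rewrite /= /mrestr setICl measure0.
Qed.

Variables (E : set W) (mE : measurable E) (s : {nonneg R}).

(* The measure (P + s P|_E) / (1 + s P(E)). *)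
Definition tilt : probability W R :=
  mnormalize (measure_add P (mscale s (mrestr P mE))) P.

Let Z : R := (1 + s%:num * fine (P E))%R.

Lemma tilt_weight_gt0 : (0 < Z)%R.
Proof. by rewrite ltr_pwDl// mulr_ge0// fine_ge0. Qed.

Let tiltE X : tilt X = (P X + s%:num%:E * P (X `&` E)) * (Z^-1)%:E.
Proof.
have ZE : measure_add P (mscale s (mrestr P mE)) setT = Z%:E.
  rewrite measure_addE /= probability_setT /mscale/= /mrestr setTI.
  by rewrite -[P E]fineK ?fin_num_measure.
(* The mass [Z] is positive and finite, so the default measure of [mnormalize] does not occur. *)
have mnormalizeE (m : {measure set W -> \bar R}) : m setT = Z%:E ->
    mnormalize m P X = m X * (Z^-1)%:E.
  by move=> mZ; rewrite /mnormalize mZ eqe gt_eqF ?tilt_weight_gt0.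
transitivity (measure_add P (mscale s (mrestr P mE)) X * (Z^-1)%:E).
  exact: mnormalizeE ZE.
by rewrite measure_addE.
Qed.

Lemma integral_tilt X (f : W -> \bar R) :
  measurable X -> measurable_fun [set: W] f -> (forall w, 0 <= f w) ->
  \int[tilt]_(w in X) f w =
  (Z^-1)%:E * (\int[P]_(w in X) f w + s%:num%:E * \int[P]_(w in X `&` E) f w).
Proof.
move=> mX mf f0.
have Z0 : (0 <= Z^-1)%R by rewrite invr_ge0 ltW// tilt_weight_gt0.
rewrite (@eq_measure_integral _ _ _ _
  (mscale (NngNum Z0) (measure_add P (mscale s (mrestr P mE))))); last first.
  move=> A mA _; rewrite [LHS]tiltE muleC.
  by rewrite -[P A + _](measure_addE P (mscale s (mrestr P mE))).
have mfX := measurable_funS measurableT (@subsetT _ X) mf.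
by rewrite ge0_integral_mscale// ge0_integral_measure_add//
  ge0_integral_mscale// integral_mrestr.
Qed.

Lemma tilt_dominates X : tilt X = 0 -> P X = 0.
Proof.
move=> tX; have : P X + s%:num%:E * P (X `&` E) = 0.
  apply/eqP; move/eqP: tX; rewrite tiltE mule_eq0 => /orP[//|].
  by rewrite eqe invr_eq0 gt_eqF ?tilt_weight_gt0.
move/eqP; rewrite padde_eq0 ?measure_ge0 ?mule_ge0 ?measure_ge0// ?lee_fin//.
by move=> /andP[/eqP].
Qed.

(** The Markov identity is linear in the measure, so it passes to the tilt from [P] and from [P]
    restricted to [E]. Here [X] is a past event, [Y] concerns the next state and [f] is its
    conditional probability. *)
Lemma tilt_setI X Y (f : W -> \bar R) :
  measurable X -> measurable_fun [set: W] f -> (forall w, 0 <= f w) ->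
  P (X `&` Y) = \int[P]_(w in X) f w ->
  P (X `&` E `&` Y) = \int[P]_(w in X `&` E) f w ->
  tilt (X `&` Y) = \int[tilt]_(w in X) f w.
Proof.
by move=> mX mf f0 XY XEY; rewrite tiltE integral_tilt// muleC XY setIAC XEY.
Qed.

End tilt.

Import HBNNSimple.

(** * From events to weights measurable for a sub-sigma-algebra *)

Section weight.
Context d (W : measurableType d) (R : realType) (P : probability W R).
Context (F : set (set W)) (FW : <<s F >> `<=` measurable).
Local Open Scope ereal_scope.

Let integral_nnsfunM (phi : {nnsfun g_sigma_algebraType F >-> R}) (f : W -> \bar R) :
  measurable_fun [set: W] f -> (forall w, 0 <= f w) ->
  \int[P]_w ((phi w)%:E * f w) =
  \sum_(y \in range phi) y%:E * \int[P]_(w in phi @^-1` [set y]) f w.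
Proof.
move=> mf f0.
have mphi y : measurable (phi @^-1` [set y] : set W).
  by apply: FW; exact: (measurable_funPTI phi (measurable_set1 y)).
have term0 y w : 0 <= (y * \1_(phi @^-1` [set y]) w)%:E * f w.
  by rewrite mule_ge0// EFinM nnfun_muleindic_ge0.
transitivity (\int[P]_w \sum_(y \in range phi)
    (y * \1_(phi @^-1` [set y]) w)%:E * f w).
  apply: eq_integral => w _; rewrite fimfunE -fsumEFin// ge0_mule_fsuml//.
  by move=> y; rewrite EFinM nnfun_muleindic_ge0.
rewrite ge0_integral_fsum//; last first.
  move=> y; apply: emeasurable_funM => //; apply/measurable_EFinP.
  by apply: measurable_funM => //; exact: measurable_indic.
apply: eq_fsbigr => y /set_mem [w0 _ <-].
rewrite [in RHS]integral_mkcond -ge0_integralZl//; last 3 first.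
- by apply/(measurable_restrictT _ _).1 => //; exact: measurable_funTS.
- by move=> w _; rewrite /patch; case: ifP.
- by rewrite lee_fin.
apply: eq_integral => w _.
by rewrite epatch_indic EFinM -muleA [_ * f w]muleC.
Qed.

(** Linearity extends the bound from events to simple functions, and monotone convergence extends it
    to [h]. The simple functions are built over the generated sigma-algebra, so that their level
    sets are events covered by the hypothesis. *)
Lemma le_integral_weight (f : W -> \bar R) (c : R) (h : W -> R) :
  measurable_fun [set: W] f -> (forall w, 0 <= f w) ->
  (forall w, f w \is a fin_num) -> (0 <= c)%R ->
  (forall E, <<s F >> E -> \int[P]_(w in E) f w <= c%:E * P E) ->
  @measurable_fun _ _ (g_sigma_algebraType F) R setT h -> (forall w, 0 <= h w)%R ->
  \int[P]_w ((h w)%:E * f w) <= c%:E * \int[P]_w (h w)%:E.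
Proof.
move=> mf f0 ffin c0 fc mhF h0.
have FWfun (u : W -> R) : @measurable_fun _ _ (g_sigma_algebraType F) R setT u ->
    measurable_fun [set: W] u by move=> mu _ Y mY; apply: FW; exact: mu.
have mh : measurable_fun [set: g_sigma_algebraType F] (EFin \o h).
  exact/measurable_EFinP.
pose phi := nnsfun_approx measurableT mh.
have mphi n : measurable_fun [set: W] (phi n) by apply: FWfun; exact: measurable_funP.
have phi_cvg w : (phi n w)%:E @[n --> \oo] --> (h w)%:E.
  by apply: (cvg_nnsfun_approx measurableT mh) => // x _; rewrite lee_fin.
have phi_nd w : {homo (fun n => phi n w) : a b / (a <= b)%N >-> (a <= b)%R}.
  by move=> a b ab; exact/lefP/nd_nnsfun_approx.
have -> : \int[P]_w ((h w)%:E * f w) = limn (fun n => \int[P]_w ((phi n w)%:E * f w)).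
  rewrite -monotone_convergence//.
  - apply: eq_integral => w _; apply/esym/cvg_lim => //.
    exact: cvgeZr.
  - by move=> n; apply: emeasurable_funM => //; exact/measurable_EFinP.
  - by move=> n w _; rewrite mule_ge0// lee_fin.
  - by move=> w _ a b ab; rewrite lee_wpmul2r// lee_fin; exact: phi_nd.
apply: lime_le.
  apply: ereal_nondecreasing_is_cvgn => a b ab; apply: ge0_le_integral => //.
  - by move=> w _; rewrite mule_ge0// lee_fin.
  - by apply: emeasurable_funM => //; exact/measurable_EFinP.
  - by apply: emeasurable_funM => //; exact/measurable_EFinP.
  - by move=> w _; rewrite lee_wpmul2r// lee_fin; exact: phi_nd.
apply: nearW => n.
apply: (@le_trans _ _ (\int[P]_w ((phi n w)%:E * c%:E))).
  rewrite integral_nnsfunM// (@integral_nnsfunM _ (cst c%:E))//.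
  apply: lee_fsum => // y /= [w0 _ <-]; rewrite lee_wpmul2l ?lee_fin//.
  have phiy : <<s F >> (phi n @^-1` [set phi n w0]).
    exact: (measurable_funPTI (phi n) (measurable_set1 _)).
  by rewrite integral_cst ?fc//; exact: FW.
under eq_integral do rewrite muleC.
rewrite ge0_integralZl ?lee_fin//; last first.
- by move=> w _; rewrite lee_fin.
- exact/measurable_EFinP.
rewrite lee_wpmul2l ?lee_fin//; apply: ge0_le_integral => //.
- by move=> w _; rewrite lee_fin.
- exact/measurable_EFinP.
- by apply/measurable_EFinP; exact: FWfun.
- move=> w _; rewrite -(cvg_lim _ (phi_cvg w))//.
  apply: lime_ge; first by apply/cvg_ex; exists (h w)%:E.
  by exists n => // m /= nm; rewrite lee_fin; exact: phi_nd.
Qed.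

End weight.

(** * Mean squares of random matrices *)

Section msq.
Context d (W : measurableType d) (R : realType) (P : probability W R).
Local Open Scope ereal_scope.

Definition msq n m (M : W -> 'M[R]_(n, m)) : \bar R := \int[P]_w (fro2 (M w))%:E.

Lemma msq_ge0 n m (M : W -> 'M[R]_(n, m)) : 0 <= msq M.
Proof. by apply: integral_ge0 => w _; rewrite lee_fin fro2_ge0. Qed.

Lemma expectation_euclid n (x : W -> 'cV[R]_n) :
  'E_P[fun w => (euclid_norm (x w) ^+ 2)%R] = msq x.
Proof. by rewrite unlock; apply: eq_integral => w _; rewrite euclid_normE. Qed.

Lemma measurable_fro2_EFin n m (M : W -> 'M[R]_(n, m)) :
  mx_measurable M -> measurable_fun [set: W] (fun w => (fro2 (M w))%:E).
Proof. by move=> mM; apply/measurable_EFinP; exact: measurable_fro2. Qed.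

Lemma msq_cst n (x : 'cV[R]_n) : msq (fun _ => x) = (fro2 x)%:E.
Proof. by rewrite /msq integral_cst//= probability_setT mule1. Qed.

Lemma msq_le_sum (I : Type) (r : seq I) (c : I -> R) n m n' m'
    (M : W -> 'M[R]_(n, m)) (N : I -> W -> 'M[R]_(n', m')) :
  mx_measurable M -> (forall i, mx_measurable (N i)) -> (forall i, (0 <= c i)%R) ->
  (forall w, fro2 (M w) <= \sum_(i <- r) c i * fro2 (N i w))%R ->
  msq M <= \sum_(i <- r) (c i)%:E * msq (N i).
Proof.
move=> mM mN c0 MN.
have mNc i : measurable_fun [set: W] (fun w => (c i)%:E * (fro2 (N i w))%:E).
  by apply: emeasurable_funM => //; exact: measurable_fro2_EFin.
apply: (@le_trans _ _ (\int[P]_w \sum_(i <- r) (c i)%:E * (fro2 (N i w))%:E)).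
  apply: ge0_le_integral => //.
  - by move=> w _; rewrite lee_fin fro2_ge0.
  - exact: measurable_fro2_EFin.
  - exact: emeasurable_sum.
  - move=> w _; under eq_bigr do rewrite -EFinM.
    by rewrite sumEFin lee_fin.
rewrite ge0_integral_sum//; last first.
  by move=> i w _; rewrite mule_ge0 ?lee_fin ?fro2_ge0.
apply: lee_sum => i _; rewrite ge0_integralZl ?lee_fin//.
  exact: measurable_fro2_EFin.
by move=> w _; rewrite lee_fin fro2_ge0.
Qed.

Lemma msq_leD (a b : R) n m n1 m1 n2 m2 (M : W -> 'M[R]_(n, m))
    (N1 : W -> 'M[R]_(n1, m1)) (N2 : W -> 'M[R]_(n2, m2)) :
  mx_measurable M -> mx_measurable N1 -> mx_measurable N2 -> (0 <= a)%R -> (0 <= b)%R ->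
  (forall w, fro2 (M w) <= a * fro2 (N1 w) + b * fro2 (N2 w))%R ->
  msq M <= a%:E * msq N1 + b%:E * msq N2.
Proof.
move=> mM mN1 mN2 a0 b0 MN.
apply: (@le_trans _ _ (\int[P]_w (a%:E * (fro2 (N1 w))%:E + b%:E * (fro2 (N2 w))%:E))).
  apply: ge0_le_integral => //.
  - by move=> w _; rewrite lee_fin fro2_ge0.
  - exact: measurable_fro2_EFin.
  - by apply: emeasurable_funD; apply: emeasurable_funM => //; exact: measurable_fro2_EFin.
  - by move=> w _; rewrite lee_fin.
rewrite ge0_integralD//.
- rewrite !ge0_integralZl ?lee_fin//.
  + exact: measurable_fro2_EFin.
  + by move=> w _; rewrite lee_fin fro2_ge0.
  + exact: measurable_fro2_EFin.
  + by move=> w _; rewrite lee_fin fro2_ge0.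
- by move=> w _; rewrite mule_ge0 ?lee_fin ?fro2_ge0.
- by apply: emeasurable_funM => //; exact: measurable_fro2_EFin.
- by move=> w _; rewrite mule_ge0 ?lee_fin ?fro2_ge0.
- by apply: emeasurable_funM => //; exact: measurable_fro2_EFin.
Qed.

Lemma msq_mulmx c n m p (A : W -> 'M[R]_(n, m)) (M : W -> 'M[R]_(m, p)) :
  mx_measurable A -> mx_measurable M -> (0 <= c)%R ->
  {ae P, forall w, fro2 (A w) <= c}%R ->
  msq (fun w => A w *m M w)%R <= c%:E * msq M.
Proof.
move=> mA mM c0 Ac; rewrite -ge0_integralZl ?lee_fin//; last first.
- by move=> w _; rewrite lee_fin fro2_ge0.
- exact: measurable_fro2_EFin.
apply: ae_ge0_le_integral => //.
- by move=> w _; rewrite lee_fin fro2_ge0.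
- by apply: measurable_fro2_EFin; exact: mx_measurableM.
- by move=> w _; rewrite mule_ge0 ?lee_fin ?fro2_ge0.
- by apply: emeasurable_funM => //; exact: measurable_fro2_EFin.
- apply: filterS Ac => w Acw _; rewrite lee_fin (le_trans (fro2M _ _))//.
  by rewrite ler_wpM2r ?fro2_ge0.
Qed.

Lemma eq_msq n m (M N : W -> 'M[R]_(n, m)) : M =1 N -> msq M = msq N.
Proof. by move=> MN; apply: eq_integral => w _; rewrite MN. Qed.

End msq.

(** * Transition matrices and measurability with respect to the past *)

Section transition.
Context (T : Type) (R : realType) (n : nat) (A : T -> 'M[R]_(n, n)) (W : Type).

Fixpoint transition (theta : nat -> W -> T) k w : 'M[R]_(n, n) :=
  if k is k'.+1 then (A (theta k' w) *m transition theta k' w)%R else 1%:M.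

Lemma auto_stateE (theta : nat -> W -> T) x0 k w :
  auto_state A theta x0 k w = transition theta k w *m x0.
Proof. by elim: k => [|k IH] /=; rewrite ?mul1mx// IH mulmxA. Qed.

(** Cocycle property. The new initial state depends on [w], whereas those in [EMSS] are
    deterministic; [restart] bridges this gap. *)
Lemma auto_state_shift (theta : nat -> W -> T) x0 s k w :
  auto_state A theta x0 (s + k)%N w =
  auto_state A (shifted s theta) (auto_state A theta x0 s w) k w.
Proof. by elim: k => [|k IH]; rewrite ?addn0// addnS /= IH. Qed.

Lemma fro2_transition (theta : nat -> W -> T) k w :
  fro2 (transition theta k w) = \sum_i fro2 (auto_state A theta (delta_mx i ord0) k w).
Proof. by rewrite fro2_colM; apply: eq_bigr => i _; rewrite auto_stateE. Qed.

End transition.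

Lemma mx_measurable_transition d (T : measurableType d) d' (W : measurableType d')
    (R : realType) n (A : T -> 'M[R]_(n, n)) (theta : nat -> W -> T) k :
  mx_measurable A -> (forall k, measurable_fun [set: W] (theta k)) ->
  mx_measurable (transition A theta k).
Proof.
move=> mA mtheta; elim: k => [|k IH]; first exact: mx_measurable_cst.
by apply: mx_measurableM => //; exact: mx_measurable_comp.
Qed.

Lemma mx_measurable_auto_state d (T : measurableType d) d' (W : measurableType d')
    (R : realType) n (A : T -> 'M[R]_(n, n)) (theta : nat -> W -> T)
    (M : W -> 'cV[R]_n) k :
  mx_measurable A -> (forall k, measurable_fun [set: W] (theta k)) -> mx_measurable M ->
  mx_measurable (fun w => auto_state A theta (M w) k w).
Proof.
move=> mA mtheta mM i j; under eq_fun do rewrite auto_stateE.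
by apply: mx_measurableM => //; exact: mx_measurable_transition.
Qed.

Section past_measurable.
Context d (T : measurableType d) d' (W : measurableType d') (R : realType)
  (theta : nat -> W -> T).

Definition past_mx k n m (M : W -> 'M[R]_(n, m)) : Prop :=
  @mx_measurable _ (g_sigma_algebraType (past theta k)) R n m M.

Lemma past_mx_le j k n m (M : W -> 'M[R]_(n, m)) :
  (j <= k)%N -> past_mx j M -> past_mx k M.
Proof.
move=> jk mM a b _ Y mY; apply: (past_le jk).
exact: (mM a b measurableT Y mY).
Qed.

Lemma past_mx_measurable k n m (M : W -> 'M[R]_(n, m)) :
  (forall k, measurable_fun [set: W] (theta k)) -> past_mx k M -> mx_measurable M.
Proof.
move=> mtheta mM a b _ Y mY; apply: (past_measurable mtheta).
exact: (mM a b measurableT Y mY).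
Qed.

Lemma past_mx_comp i k n m (A : T -> 'M[R]_(n, m)) :
  (i <= k)%N -> mx_measurable A -> past_mx k (fun w => A (theta i w)).
Proof.
move=> ik mA; apply: (@mx_measurable_comp _ _ T (g_sigma_algebraType (past theta k))) => //.
by move=> _ L mL; rewrite setTI; exact: past_preimage.
Qed.

(** The state at time [k.+1] has used the chain only up to time [k]; this one-step lead makes it an
    admissible initial state for a restart at [k.+1]. *)
Lemma past_mx_auto_state n (A : T -> 'M[R]_(n, n)) x0 k :
  mx_measurable A -> past_mx k (auto_state A theta x0 k.+1).
Proof.
move=> mA; elim: k => [|k IH].
  by apply: mx_measurableM; [exact: past_mx_comp|exact: mx_measurable_cst].
apply: mx_measurableM; first exact: past_mx_comp.
exact: past_mx_le IH.
Qed.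

Lemma past_mx_state n m p (S : mjls T R n m p) x0 (v : nat -> W -> 'cV[R]_m) k :
  mx_measurable (sysA S) -> mx_measurable (sysB S) -> (forall k, past_mx k (v k)) ->
  past_mx k (state S theta x0 v k.+1).
Proof.
move=> mA mB mv; elim: k => [|k IH].
  apply: mx_measurableD; apply: mx_measurableM.
  - exact: past_mx_comp.
  - exact: mx_measurable_cst.
  - exact: past_mx_comp.
  - exact: mv.
apply: mx_measurableD; apply: mx_measurableM.
- exact: past_mx_comp.
- exact: past_mx_le IH.
- exact: past_mx_comp.
- exact: mv.
Qed.

End past_measurable.

Section restart.
Context d (T : measurableType d) (R : realType)
  (mu : {sigma_finite_measure set T -> \bar R})
  (G : R.-pker T ~> T) (g : T -> T -> R) (Gg : has_density mu G g).
Local Open Scope ereal_scope.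
Hypothesis g_gt0 : {ae mu, forall l, 0 < \int[mu]_t (g t l)%:E}.
Context d' (W : measurableType d') (theta : nat -> W -> T)
  (P : probability W R) (nu0 : T -> R).
Hypothesis chainP : markov_chain mu G P nu0 theta.

Let mtheta k : measurable_fun [set: W] (theta k).
Proof. by case: chainP. Qed.

(* Conditioning on E would destroy the positivity of the density of the shifted
   chain, whence the tilts by 1 + s 1_E with s tending to infinity. *)
Lemma restart_set j (f : W -> \bar R) (c : R) :
  measurable_fun [set: W] f -> (forall w, 0 <= f w) -> (0 <= c)%R ->
  (forall (P' : probability W R) nu, markov_chain mu G P' nu (shifted j.+1 theta) ->
    \int[P']_w f w <= c%:E) ->
  forall E, <<s past theta j >> E -> \int[P]_(w in E) f w <= c%:E * P E.
Proof.
move=> mf f0 c0 fc E FE; have mE := past_measurable mtheta FE.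
apply/lee_addgt0Pr => e e0.
(* With this [s] the error term [c / s] is [c * e / (c + 1)], which is at most [e]; the [+ 1] keeps
   [s] positive when [c] is 0. *)
have s0 : (0 < (c + 1) / e)%R by rewrite divr_gt0// ltr_wpDl.
pose s := NngNum (ltW s0).
have [nu chain'] : exists nu, markov_chain mu G (tilt P mE s) nu (shifted j.+1 theta).
  apply: (chain_shift Gg mtheta chainP) => //.
    by move=> L _; exact: tilt_dominates.
  move=> k X L jk FX mL; have mX := past_measurable mtheta FX.
  apply: tilt_setI => //.
  - by apply: (measurableT_comp (f := G ^~ L)) => //; exact: measurable_kernel.
  - by case: chainP => _ _ _ _ ->.
  (* Since [j <= k], the event [E] lies in F_k, and the Markov property applies to its intersection
     with [X]. *)
  - case: chainP => _ _ _ _ -> //.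
    exact: (@measurableI _ (g_sigma_algebraType (past theta k)) X E FX (past_le jk FE)).
have := fc _ _ chain'.
rewrite integral_tilt// setTI muleC lee_pdivrMr ?tilt_weight_gt0//= => le1.
have b0 : 0 <= \int[P]_(w in E) f w by apply: integral_ge0 => w _.
have {le1} : ((c + 1) / e)%:E * \int[P]_(w in E) f w <=
    c%:E * (1 + (c + 1) / e * fine (P E))%:E.
  by apply: le_trans le1; rewrite leeDr// integral_ge0.
rewrite -lee_pdivlMl// => /le_trans; apply.
have PE : P E = (fine (P E))%:E by rewrite fineK ?fin_num_measure.
rewrite PE/= -!EFinM -EFinD lee_fin; set p := fine _.
have c1 : (0 < c + 1)%R by rewrite ltr_wpDl.
rewrite [leLHS](_ : _ = c * p + c * e / (c + 1))%R; last first.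
  by field; rewrite !gt_eqF.
by rewrite lerD2l ler_pdivrMr// mulrC ler_pM2l//; lra.
Qed.

(* The factor n comes from bounding the random transition matrix by its images
   of the n basis vectors. *)
Lemma restart n (A : T -> 'M[R]_(n, n)) (r : seq nat) (c : R) j (M : W -> 'cV[R]_n) :
  mx_measurable A -> (0 <= c)%R ->
  (forall (P' : probability W R) nu theta', markov_chain mu G P' nu theta' ->
    forall x0, \sum_(m <- r) msq P' (auto_state A theta' x0 m) <= (c * fro2 x0)%:E) ->
  past_mx theta j M ->
  \sum_(m <- r) msq P (fun w => auto_state A (shifted j.+1 theta) (M w) m w)
    <= (n%:R * c)%:E * msq P M.
Proof.
move=> mA c0 Ac FM; have mM := past_mx_measurable mtheta FM.
have mshift k : measurable_fun [set: W] (shifted j.+1 theta k) by exact: mtheta.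
have mtr m := mx_measurable_transition (W := W) m mA mshift.
(* Submultiplicativity separates the random initial state from the dynamics: [fro2 (M w)] becomes a
   weight of the past, and [f] involves only the shifted chain. *)
pose f w := \sum_(m <- r) (fro2 (transition A (shifted j.+1 theta) m w))%:E.
have f0 w : 0 <= f w by apply: sume_ge0 => m _; rewrite lee_fin fro2_ge0.
have mf : measurable_fun [set: W] f.
  by apply: emeasurable_sum => m; exact: measurable_fro2_EFin.
have fc (P' : probability W R) nu : markov_chain mu G P' nu (shifted j.+1 theta) ->
    \int[P']_w f w <= (n%:R * c)%:E.
  move=> chain'; rewrite ge0_integral_sum//; last 2 first.
  - by move=> m; exact: measurable_fro2_EFin.
  - by move=> m w _; rewrite lee_fin fro2_ge0.
  apply: (@le_trans _ _ (\sum_(i < n) (c * fro2 (delta_mx i (@ord0 0)))%:E)).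
    have {}Ac (i : 'I_n) : \sum_(m <- r)
        msq P' (auto_state A (shifted j.+1 theta) (delta_mx i ord0) m) <=
        (c * fro2 (delta_mx i (@ord0 0)))%:E by exact: Ac chain' _.
    apply: le_trans; last by apply: lee_sum => i _; exact: Ac.
    rewrite exchange_big/=; apply: lee_sum => m _.
    have := @msq_le_sum _ W R P' 'I_n (index_enum 'I_n) (fun _ => 1%R) _ _ _ _
      (transition A (shifted j.+1 theta) m)
      (fun i => auto_state A (shifted j.+1 theta) (delta_mx i ord0) m).
    under [X in _ -> _ -> _ -> _ -> _ <= X]eq_bigr do rewrite mul1e.
    apply => //.
      by move=> i; apply: mx_measurable_auto_state => //; exact: mx_measurable_cst.
    move=> w; rewrite fro2_transition.
    by under [leRHS]eq_bigr do rewrite mul1r.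
  under eq_bigr do rewrite fro2_delta mulr1.
  by rewrite sumEFin lee_fin sumr_const card_ord mulr_natl.
have nc0 : (0 <= n%:R * c)%R by rewrite mulr_ge0.
apply: (@le_trans _ _ (\int[P]_w ((fro2 (M w))%:E * f w))).
  rewrite -ge0_integral_sum//.
  - apply: ge0_le_integral => //.
    + by move=> w _; apply: sume_ge0 => m _; rewrite lee_fin fro2_ge0.
    + apply: emeasurable_sum => m; apply: measurable_fro2_EFin.
      exact: mx_measurable_auto_state.
    + by apply: emeasurable_funM => //; exact: measurable_fro2_EFin.
    + move=> w _; rewrite ge0_sume_distrr; last by move=> m _; rewrite lee_fin fro2_ge0.
      by apply: lee_sum => m _; rewrite auto_stateE -EFinM lee_fin mulrC fro2M.
  - by move=> m; apply: measurable_fro2_EFin; exact: mx_measurable_auto_state.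
  - by move=> m w _; rewrite lee_fin fro2_ge0.
apply: (le_integral_weight (F := past theta j)) => //.
- exact: past_measurable.
- by move=> w; rewrite /f sumEFin.
- exact: restart_set.
- exact: measurable_fro2.
- by move=> w; exact: fro2_ge0.
Qed.

End restart.

(** * Input-to-state and input-to-output gains *)

(** Each [e j] receives a finite geometric sum; keeping its remainder exactly makes the induction on
    [N] go through. *)
Lemma geometric_convolution (R : realType) (rho : R) (e : nat -> R) N : rho != 1 ->
  \sum_(k < N) \sum_(j < k) rho ^+ (k - j.+1) * e j =
  (1 - rho)^-1 * (\sum_(j < N) e j - \sum_(j < N) rho ^+ (N - j.+1) * e j).
Proof.
move=> rho1; have step k : \sum_(j < k.+1) rho ^+ (k.+1 - j.+1) * e j =
    rho * (\sum_(j < k) rho ^+ (k - j.+1) * e j) + e k.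
  rewrite big_ord_recr/= subnn mul1r mulr_sumr; congr (_ + _).
  by apply: eq_bigr => j _; rewrite subSn// exprS mulrA.
elim: N => [|N IH]; first by rewrite !big_ord0 subr0 mulr0.
by rewrite step !big_ord_recr/= IH; field; rewrite subr_eq0 eq_sym.
Qed.

Lemma sum_expr_le (R : realType) (rho : R) N : 0 <= rho < 1 ->
  \sum_(k < N) rho ^+ k <= (1 - rho)^-1.
Proof.
move=> /andP[rho0 rho1]; have rhoB : 0 < 1 - rho by rewrite subr_gt0.
rewrite -div1r ler_pdivlMr//; have := subrX1 rho N.
have := exprn_ge0 N rho0; set s := \sum_(k < N) _; lra.
Qed.

Section state.
Context (T : Type) (R : realType) (n m p : nat) (S : mjls T R n m p) (W : Type)
  (theta : nat -> W -> T).

(** Variation of constants. The input at time [j] acts as an initial state at time [j.+1], and this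
    state is measurable at time [j] for an adapted input, so [restart] applies to each term. *)
Lemma state_convolution (v : nat -> W -> 'cV[R]_m) k w :
  state S theta 0 v k w = \sum_(j < k) auto_state (sysA S) (shifted j.+1 theta)
    (sysB S (theta j w) *m v j w) (k - j.+1) w.
Proof.
elim: k => [|k IH]; first by rewrite big_ord0.
rewrite big_ord_recr/= subnn /= IH mulmx_sumr; congr (_ + _).
by apply: eq_bigr => j _; rewrite subSn//= /shifted subnKC.
Qed.

Lemma state_superposition x0 (v : nat -> W -> 'cV[R]_m) k w :
  state S theta x0 v k w = auto_state (sysA S) theta x0 k w + state S theta 0 v k w.
Proof.
elim: k => [|k IH] /=; first by rewrite addr0.
by rewrite IH mulmxDr addrA.
Qed.

Definition truncate N (v : nat -> W -> 'cV[R]_m) k w : 'cV[R]_m :=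
  if (k < N)%N then v k w else 0.

(** Causality: the state at time [k] sees inputs strictly before [k], so [k = N] is allowed. *)
Lemma state_truncate x0 (v : nat -> W -> 'cV[R]_m) N k w : (k <= N)%N ->
  state S theta x0 (truncate N v) k w = state S theta x0 v k w.
Proof. by elim: k => [//|k IH] kN /=; rewrite IH 1?ltnW// /truncate kN. Qed.

Definition output x0 (v : nat -> W -> 'cV[R]_m) k w : 'cV[R]_p :=
  sysC S (theta k w) *m state S theta x0 v k w + sysD S (theta k w) *m v k w.

Lemma outputE x0 (v : nat -> W -> 'cV[R]_m) N k w : (k < N)%N ->
  output x0 v k w = sysC S (theta k w) *m auto_state (sysA S) theta x0 k w +
    io_operator S theta (truncate N v) k w.
Proof.
move=> kN; rewrite /output /io_operator state_superposition mulmxDr -addrA.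
by rewrite state_truncate 1?ltnW// /truncate kN.
Qed.

End state.

(** * The l2 norm and its partial sums *)

Section l2.
Context d' (W : measurableType d') (R : realType) (P : probability W R).
Local Open Scope ereal_scope.

Lemma l2_normsqE r (v : nat -> W -> 'cV[R]_r) :
  l2_normsq P v = \sum_(0 <= k <oo) msq P (v k).
Proof. by apply: eq_eseriesr => k _; rewrite expectation_euclid. Qed.

Lemma l2_normsq_ge0 r (v : nat -> W -> 'cV[R]_r) : 0 <= l2_normsq P v.
Proof. by rewrite l2_normsqE; apply: nneseries_ge0 => k _ _; exact: msq_ge0. Qed.

Lemma sum_msq_le_l2 r (v : nat -> W -> 'cV[R]_r) N :
  \sum_(k < N) msq P (v k) <= l2_normsq P v.
Proof.
rewrite l2_normsqE -(big_mkord xpredT (fun k => msq P (v k))).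
by apply: nneseries_lim_ge => k _ _; exact: msq_ge0.
Qed.

Lemma l2_le_sum_msq r (v : nat -> W -> 'cV[R]_r) x :
  (forall N, \sum_(k < N) msq P (v k) <= x) -> l2_normsq P v <= x.
Proof.
move=> vx; rewrite l2_normsqE; apply: lime_le.
  by apply: is_cvg_nneseries => k _ _; exact: msq_ge0.
by apply: nearW => N; rewrite big_mkord.
Qed.

Lemma msq_le_l2 r (v : nat -> W -> 'cV[R]_r) k : msq P (v k) <= l2_normsq P v.
Proof.
apply: le_trans (sum_msq_le_l2 v k.+1); rewrite big_ord_recr/= leeDr//.
by apply: sume_ge0 => j _; exact: msq_ge0.
Qed.

Lemma l2_normsq_truncate N r (v : nat -> W -> 'cV[R]_r) :
  l2_normsq P (truncate N v) <= \sum_(k < N) msq P (v k).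
Proof.
rewrite l2_normsqE (nneseries_split 0 N)//; last by move=> k _; exact: msq_ge0.
rewrite add0n [X in _ + X]eseries0 ?adde0.
  rewrite big_mkord; apply: lee_sum => k _.
  by rewrite (eq_msq P (N := v k))// => w; rewrite /truncate ltn_ord.
move=> k Nk _; rewrite (eq_msq P (N := fun=> 0%R)); last first.
  by move=> w; rewrite /truncate ltnNge Nk.
by rewrite /msq; apply: integral0_eq => w _; rewrite fro2_0.
Qed.

Lemma msq_eq0 r (v : W -> 'cV[R]_r) : mx_measurable v -> msq P v = 0 ->
  {ae P, forall w, v w = 0%R}.
Proof.
move=> mv v0; have /ae_eq_integral_abs : \int[P]_w `|(fro2 (v w))%:E| = 0.
  by rewrite -[RHS]v0; apply: eq_integral => w _; rewrite gee0_abs// lee_fin fro2_ge0.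
move=> /(_ measurableT (measurable_fro2_EFin mv)); apply: filterS => w /(_ I) [/eqP].
rewrite psumr_eq0; last by move=> i _; apply: sumr_ge0 => j _; exact: sqr_ge0.
move=> /allP vw; apply/matrixP => i j; have := vw i (mem_index_enum _).
rewrite psumr_eq0/=; last by move=> j' _; exact: sqr_ge0.
by move=> /allP/(_ j (mem_index_enum _)); rewrite sqrf_eq0 mxE => /eqP.
Qed.

End l2.

Section gain.
Context d (T : measurableType d) (R : realType)
  (mu : {sigma_finite_measure set T -> \bar R})
  (G : R.-pker T ~> T) (g : T -> T -> R) (Gg : has_density mu G g).
Local Open Scope ereal_scope.
Hypothesis g_gt0 : {ae mu, forall l, 0 < \int[mu]_t (g t l)%:E}.

Lemma EMSS_msq n (A : T -> 'M[R]_(n, n)) : EMSS mu G A ->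
  exists beta alpha : R, [/\ (0 < beta)%R, (0 < alpha < 1)%R &
    forall d' (W : measurableType d') (P : probability W R) nu0 theta,
      markov_chain mu G P nu0 theta -> forall x0 k,
        msq P (auto_state A theta x0 k) <= (beta * alpha ^+ k * fro2 x0)%:E].
Proof.
move=> [beta [alpha [b0 a01 H]]]; exists beta, alpha.
split => // d' W P nu0 theta ch x0 k.
by have := H _ _ _ _ _ ch x0 k; rewrite expectation_euclid euclid_normE.
Qed.

Variables (n m p : nat) (S : mjls T R n m p).
Hypotheses (mA : mx_measurable (sysA S)) (mB : mx_measurable (sysB S))
  (mC : mx_measurable (sysC S)) (mD : mx_measurable (sysD S)).
Hypotheses (bB : essbounded mu (sysB S)) (bC : essbounded mu (sysC S))
  (bD : essbounded mu (sysD S)).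
Hypothesis stable : EMSS mu G (sysA S).

Let chain_theta d' (W : measurableType d') (P : probability W R) nu0 theta :
  markov_chain mu G P nu0 theta -> forall k, measurable_fun [set: W] (theta k).
Proof. by case. Qed.

(* Weighted Cauchy-Schwarz with weights rho ^+ (k - j.+1), where rho = sqrt alpha:
   half of the decay makes the weights summable, the other half the gain. *)
Lemma state_gain : exists2 K : R, (0 < K)%R &
  forall d' (W : measurableType d') (P : probability W R) nu0 theta,
    markov_chain mu G P nu0 theta -> forall (v : nat -> W -> 'cV[R]_m) (e : nat -> R),
    (forall k, past_mx theta k (v k)) -> (forall k, msq P (v k) <= (e k)%:E) ->
    forall N, \sum_(k < N) msq P (state S theta 0 v k) <= (K * \sum_(k < N) e k)%:E.
Proof.
have [beta [alpha [beta0 /andP[alpha0 alpha1] decay]]] := EMSS_msq stable.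
have [b [b0 Bb]] := bB.
pose rho := Num.sqrt alpha.
have rho0 : (0 < rho)%R by rewrite sqrtr_gt0.
have rho1 : (rho < 1)%R by rewrite -sqrtr1 ltr_sqrt.
have rhoB : (0 < 1 - rho)%R by rewrite subr_gt0.
have alphaE : (alpha = rho ^+ 2)%R by rewrite sqr_sqrtr// ltW.
(* This [(1 - rho)^-1] bounds the sum of the Cauchy-Schwarz weights; the second one, in the gain
   below, comes from summing the remaining kernel over time. The factors [n], [beta] and [b] come
   from the restart, the decay and the bound on B. *)
pose K0 := ((1 - rho)^-1 * (n%:R * beta * b))%R.
have K00 : (0 <= K0)%R by rewrite mulr_ge0 ?invr_ge0 ?mulr_ge0// ltW.
exists (K0 * (1 - rho)^-1 + 1)%R; first by rewrite ltr_wpDl// mulr_ge0// invr_ge0 ltW.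
move=> d' W P nu0 theta ch v e Fv ve N.
have mtheta := chain_theta ch.
have mv k := past_mx_measurable mtheta (Fv k).
have e0 k : (0 <= e k)%R by rewrite -lee_fin (le_trans _ (ve k))// msq_ge0.
have mxB k : mx_measurable (fun w => sysB S (theta k w)) by exact: mx_measurable_comp.
pose y k j w := auto_state (sysA S) (shifted j.+1 theta)
    (sysB S (theta j w) *m v j w)%R (k - j.+1) w.
have my k j : mx_measurable (y k j).
  apply: mx_measurable_auto_state => //; last exact: mx_measurableM.
  by move=> i; exact: mtheta.
have msq_y k j : msq P (y k j) <= (n%:R * beta * b * rho ^+ (k - j.+1) ^+ 2 * e j)%:E.
  (* A restart observed at the single lag [k - j.+1], so that the decay factor survives in the
     constant. *)
  have := restart Gg g_gt0 ch (r := [:: (k - j.+1)%N]) (c := beta * alpha ^+ (k - j.+1))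
    (j := j) (M := fun w => sysB S (theta j w) *m v j w)%R mA.
  rewrite big_seq1 => /(_ _ _ _)/le_trans; apply.
  - by rewrite mulr_ge0 ?exprn_ge0 ?ltW.
  - by move=> P' nu theta' ch' x0; rewrite big_seq1; exact: decay ch' x0 _.
  - by apply: mx_measurableM; [exact: past_mx_comp|exact: Fv].
  apply: (@le_trans _ _ ((n%:R * (beta * alpha ^+ (k - j.+1)))%:E * (b * e j)%:E)).
    apply: lee_wpmul2l; first by rewrite lee_fin !mulr_ge0 ?exprn_ge0// ltW.
    apply: (le_trans (msq_mulmx (mxB j) (mv j) (ltW b0) (chain_ae Gg mtheta ch j Bb))).
    by rewrite EFinM lee_wpmul2l// lee_fin ltW.
  rewrite -EFinM lee_fin alphaE -!exprM mulnC le_eqVlt; apply/orP; left; apply/eqP.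
  by ring.
have msq_state k : msq P (state S theta 0 v k) <=
    (K0 * \sum_(j < k) rho ^+ (k - j.+1) * e j)%:E.
  apply: (@le_trans _ _ (\sum_(j < k)
      ((1 - rho)^-1 * (rho ^+ (k - j.+1))^-1)%:E * msq P (y k j))).
    apply: msq_le_sum => //.
    - move=> i i'; under eq_fun do rewrite state_convolution summxE.
      by apply: measurable_sum => j; exact: my.
    - by move=> j; rewrite mulr_ge0// invr_ge0 ?exprn_ge0// ltW.
    - move=> w; rewrite state_convolution.
      have rk0 (j : 'I_k) : (0 < rho ^+ (k - j.+1))%R by rewrite exprn_gt0.
      have := fro2_sum_weighted (fun j : 'I_k => y k j w) rk0.
      move=> /le_trans; apply.
      under [leRHS]eq_bigr do rewrite -mulrA.
      rewrite -mulr_sumr ler_wpM2r//.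
        apply: sumr_ge0 => j _.
        by rewrite mulr_ge0 ?fro2_ge0// invr_ge0 exprn_ge0// ltW.
      have := sum_expr_le k (rho := rho).
      by rewrite (reindex_inj rev_ord_inj)/=; apply; rewrite rho1 ltW.
  rewrite mulr_sumr -sumEFin; apply: lee_sum => j _.
  apply: (le_trans (lee_wpmul2l _ (msq_y k j))).
    by rewrite lee_fin mulr_ge0// invr_ge0 ?exprn_ge0// ltW.
  rewrite -EFinM lee_fin /K0 le_eqVlt; apply/orP; left; apply/eqP.
  by field; rewrite expf_neq0 ?gt_eqF.
apply: le_trans; first by apply: lee_sum => k _; exact: msq_state.
rewrite sumEFin lee_fin -mulr_sumr geometric_convolution ?lt_eqF// mulrDl mul1r mulrA.
have K1 : (0 <= K0 / (1 - rho))%R by apply: mulr_ge0 => //; rewrite invr_ge0 ltW.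
rewrite ler_wpDr ?sumr_ge0//; apply: ler_wpM2l => //.
by rewrite gerBl sumr_ge0// => j _; rewrite mulr_ge0// exprn_ge0// ltW.
Qed.

Lemma in_l2_past_mx d' (W : measurableType d') (P : probability W R)
    (theta : nat -> W -> T) r (v : nat -> W -> 'cV[R]_r) :
  in_l2 P theta v -> forall k, past_mx theta k (v k).
Proof. by move=> [mv _] k i j; rewrite ord1; exact: mv. Qed.

Lemma past_mx_output d' (W : measurableType d') (theta : nat -> W -> T) x0
    (v : nat -> W -> 'cV[R]_m) : (forall k, past_mx theta k (v k)) ->
  forall k, past_mx theta k (output S theta x0 v k).
Proof.
move=> Fv k; apply: mx_measurableD; apply: mx_measurableM.
- exact: past_mx_comp.
- case: k => [|k]; first exact: mx_measurable_cst.
  by apply: (@past_mx_le _ _ _ _ _ _ k) => //; exact: past_mx_state.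
- exact: past_mx_comp.
- exact: Fv.
Qed.

(** The condition inside [io_norm] in non-strict form, which also covers almost surely zero inputs;
    truncated loop signals may be of this kind. *)
Definition l2_gain (gamma : R) : Prop :=
  forall d' (W : measurableType d') (P : probability W R) nu0 theta,
    markov_chain mu G P nu0 theta -> forall v : nat -> W -> 'cV[R]_m,
    in_l2 P theta v ->
    l2_normsq P (io_operator S theta v) <= gamma%:E * l2_normsq P v.

(** A crude gain from stability and bounded coefficients. It serves to show that [io_norm] is finite
    and that almost surely zero inputs have zero output norm. *)
Lemma l2_gain_exists : exists2 K : R, (0 < K)%R & l2_gain K.
Proof.
have [K K0 gainK] := state_gain.
have [c [c0 Cc]] := bC; have [e [e0 De]] := bD.
exists (2 * c * K + 2 * e)%R; first by rewrite addr_gt0 ?mulr_gt0.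
move=> d' W P nu0 theta ch v v2.
have mtheta := chain_theta ch.
have Fv := in_l2_past_mx v2.
have mv k := past_mx_measurable mtheta (Fv k).
have vfin k : msq P (v k) = (fine (msq P (v k)))%:E.
  rewrite fineK// ge0_fin_numE ?msq_ge0//.
  by apply: le_lt_trans (msq_le_l2 P v k) _; case: v2.
have mstate k : mx_measurable (state S theta 0%R v k).
  case: k => [|k]; first exact: mx_measurable_cst.
  exact: past_mx_measurable (past_mx_state _ _ _ _).
apply: l2_le_sum_msq => N.
apply: (@le_trans _ _ (\sum_(k < N) ((2 * c)%:E * msq P (state S theta 0%R v k)
    + (2 * e)%:E * msq P (v k)))).
  apply: lee_sum => k _.
  have mCk : mx_measurable (fun w => sysC S (theta k w)) by exact: mx_measurable_comp.
  have mDk : mx_measurable (fun w => sysD S (theta k w)) by exact: mx_measurable_comp.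
  have mCx := mx_measurableM mCk (mstate k).
  have mDv := mx_measurableM mDk (mv k).
  have := msq_leD P (a := 2) (b := 2) (mx_measurableD mCx mDv) mCx mDv.
  move=> /(_ (ler0n _ _) (ler0n _ _) (fun w => fro2D _ _)) /le_trans; apply.
  rewrite !EFinM -!muleA. apply: leeD; apply: lee_wpmul2l => //.
    exact: msq_mulmx (mCk) (mstate k) (ltW c0) (chain_ae Gg mtheta ch k Cc).
  exact: msq_mulmx (mDk) (mv k) (ltW e0) (chain_ae Gg mtheta ch k De).
have le_N := gainK _ _ _ _ _ ch v (fun k => fine (msq P (v k))) Fv _ N.
rewrite big_split/= -!ge0_sume_distrr; try by move=> *; exact: msq_ge0.
apply: (@le_trans _ _ ((2 * c * K + 2 * e)%:E * (\sum_(k < N) msq P (v k)))).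
  have cK0 : (0 <= 2 * c * K)%R by rewrite !mulr_ge0// ltW.
  have e20 : (0 <= 2 * e)%R by rewrite mulr_ge0// ltW.
  rewrite EFinD ge0_muleDl ?lee_fin//.
  apply: leeD => //; rewrite [(2 * c * K)%:E]EFinM -muleA.
  apply: lee_wpmul2l; first by rewrite lee_fin mulr_ge0// ltW.
  apply: (le_trans (le_N _)); first by move=> k; rewrite -vfin.
  by rewrite EFinM -sumEFin; under eq_bigr do rewrite -vfin.
apply: lee_wpmul2l; first by rewrite lee_fin addr_ge0// !mulr_ge0// ltW.
exact: sum_msq_le_l2.
Qed.

Lemma io_norm_ge0 : 0 <= io_norm mu G S.
Proof. by apply: le_ereal_inf_tmp => _ [gamma _ <-]; rewrite lee_fin sqrtr_ge0. Qed.

Let normsq_gt0 d' (W : measurableType d') (P : probability W R)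
    (theta : nat -> W -> T) (v : nat -> W -> 'cV[R]_m) :
  (forall k, measurable_fun [set: W] (theta k)) ->
  in_l2 P theta v -> l2_nonzero P v -> 0 < l2_normsq P v.
Proof.
move=> mtheta v2 vn0; rewrite lt_neqAle l2_normsq_ge0 andbT eq_sym.
apply/negP => /eqP v0; apply: vn0 => k; apply: msq_eq0.
  have Fv := in_l2_past_mx v2. exact: (past_mx_measurable mtheta (Fv k)).
by apply/eqP; rewrite eq_le msq_ge0 andbT -v0 msq_le_l2.
Qed.

(* Excludes io_norm mu G S1 = 0 and io_norm mu G S2 = +oo, whose product is 0 in
   \bar R. *)
Lemma io_norm_lty : io_norm mu G S < +oo.
Proof.
have [K K0 gainK] := l2_gain_exists.
apply: le_lt_trans (ltry (Num.sqrt (K + 1))).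
(* Passing from [K] to [K + 1] makes the inequality strict, as the norm of a nonzero input is
   positive and finite. *)
apply: ereal_inf_lbound; exists (K + 1)%R => //; split; first by rewrite addr_gt0.
move=> d' W P nu0 theta ch v v2 vn0.
have v0 := normsq_gt0 (chain_theta ch) v2 vn0.
have vfin : l2_normsq P v \is a fin_num by rewrite gt0_fin_numE//; case: v2.
apply: (@le_lt_trans _ _ (K%:E * l2_normsq P v - (K + 1)%:E * l2_normsq P v)).
  by apply: leeD2r; exact: gainK ch v v2.
rewrite -(fineK vfin) -!EFinM -EFinB lte_fin.
have : (0 < fine (l2_normsq P v))%R by rewrite fine_gt0// v0 -ge0_fin_numE ?ltW.
by lra.
Qed.

Lemma io_norm_lt (x : R) : io_norm mu G S < x%:E ->
  exists gamma : R, [/\ (0 < gamma)%R, (Num.sqrt gamma < x)%R & l2_gain gamma].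
Proof.
move=> /ereal_inf_lt[_ [gamma [gamma0 H] <-]]; rewrite lte_fin => gx.
exists gamma; split => // d' W P nu0 theta ch v v2.
have [vn0|/contrapT v0] := pselect (l2_nonzero P v).
  have := H _ _ _ _ _ ch v v2 vn0; rewrite suber_lt0; first exact: ltW.
  by rewrite fin_numM// ge0_fin_numE ?l2_normsq_ge0//; case: v2.
(* The definition of [io_norm] is silent on an almost surely zero input; the crude gain shows that
   its output norm is 0. *)
have [K K0 gainK] := l2_gain_exists.
have l20 : l2_normsq P v = 0.
  rewrite l2_normsqE; apply: eseries0 => k _ _; rewrite /msq.
  have Fv := in_l2_past_mx v2.
  have mv := past_mx_measurable (chain_theta ch) (Fv k).
  rewrite (ge0_ae_eq_integral (g := cst 0))// ?integral0//.
  - exact: measurable_fro2_EFin.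
  - by move=> w _; rewrite lee_fin fro2_ge0.
  - by apply: filterS (v0 k) => w -> _; rewrite fro2_0.
by have := gainK _ _ _ _ _ ch v v2; rewrite l20 !mule0.
Qed.

(** Young's inequality gives the forced response the factor [1 + eps] and the free response the
    large factor [1 + eps^-1], which is absorbed in [K]. Sums up to [N] replace norms because the
    loop signals are not known to be in l2. *)
Lemma output_gain (gamma eps : R) :
  (0 < gamma)%R -> (0 < eps)%R -> l2_gain gamma ->
  exists2 K : R, (0 < K)%R &
  forall d' (W : measurableType d') (P : probability W R) nu0 theta,
    markov_chain mu G P nu0 theta ->
    forall x0 (v : nat -> W -> 'cV[R]_m) (e : nat -> R),
    (forall k, past_mx theta k (v k)) -> (forall k, msq P (v k) <= (e k)%:E) ->
    forall N,
      \sum_(k < N) msq P (output S theta x0 v k) <=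
        (K * fro2 x0 + (1 + eps) * gamma * \sum_(k < N) e k)%:E /\
      \sum_(k < N) msq P (state S theta x0 v k) <=
        (K * (fro2 x0 + \sum_(k < N) e k))%:E.
Proof.
move=> gamma0 eps0 gain.
have [beta [alpha [beta0 /andP[alpha0 alpha1] decay]]] := EMSS_msq stable.
have [L L0 gainL] := state_gain.
have [c [c0 Cc]] := bC.
pose F := (beta * (1 - alpha)^-1)%R.
have F0 : (0 < F)%R by rewrite mulr_gt0// invr_gt0 subr_gt0.
have epsV0 : (0 < eps^-1)%R by rewrite invr_gt0.
have cF0 : (0 < c * F)%R by exact: mulr_gt0.
have p0 : (0 < 1 + eps^-1)%R by exact: addr_gt0.
(* One constant for both estimates: the first term is the free response seen through C, the others
   are the free and forced parts of the state. [F] sums the geometric decay. *)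
exists ((1 + eps^-1) * (c * F) + 2 * F + 2 * L)%R.
  by have := mulr_gt0 p0 cF0; lra.
move=> d' W P nu0 theta ch x0 v e Fv ve N.
have mtheta := chain_theta ch.
have e0 : (0 <= \sum_(k < N) e k)%R.
  by apply: sumr_ge0 => k _; rewrite -lee_fin (le_trans _ (ve k))// msq_ge0.
have auto_sum : \sum_(k < N) msq P (auto_state (sysA S) theta x0 k) <= (F * fro2 x0)%:E.
  apply: le_trans; first by apply: lee_sum => k _; exact: decay ch x0 _.
  rewrite sumEFin lee_fin -mulr_suml ler_wpM2r ?fro2_ge0// -mulr_sumr.
  rewrite ler_wpM2l ?(ltW beta0)//.
  by apply: sum_expr_le; rewrite alpha1 ltW.
have mauto k : mx_measurable (auto_state (sysA S) theta x0 k).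
  by apply: (mx_measurable_auto_state k mA mtheta); exact: mx_measurable_cst.
have mstate y0 k : mx_measurable (state S theta y0 v k).
  case: k => [|k]; first exact: mx_measurable_cst.
  have Fx := past_mx_state y0 mA mB Fv.
  exact: past_mx_measurable mtheta (Fx k).
have mxC k : mx_measurable (fun w => sysC S (theta k w)) by exact: mx_measurable_comp.
have Ftr k : past_mx theta k (truncate N v k).
  rewrite /truncate; case: (k < N)%N; [exact: Fv|exact: mx_measurable_cst].
have mio k : mx_measurable (io_operator S theta (truncate N v) k).
  have Fz := past_mx_output 0%R Ftr.
  exact: past_mx_measurable mtheta (Fz k).
have mout k : mx_measurable (output S theta x0 v k).
  have Fz := past_mx_output x0 Fv.
  exact: past_mx_measurable mtheta (Fz k).
have tr_le : l2_normsq P (truncate N v) <= (\sum_(k < N) e k)%:E.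
  apply: (le_trans (l2_normsq_truncate _ _ _)); rewrite -sumEFin.
  by apply: lee_sum => k _; exact: ve.
have io_sum : \sum_(k < N) msq P (io_operator S theta (truncate N v) k) <=
    (gamma * \sum_(k < N) e k)%:E.
  apply: (le_trans (sum_msq_le_l2 _ _ _)).
  have tr2 : in_l2 P theta (truncate N v).
    split; first by move=> k i; exact: Ftr.
    exact: le_lt_trans tr_le (ltry _).
  apply: (le_trans (gain _ _ _ _ _ ch _ tr2)); rewrite EFinM.
  by apply: lee_wpmul2l => //; rewrite lee_fin ltW.
have state_sum := gainL _ _ _ _ _ ch v e Fv ve N.
have x00 := fro2_ge0 x0.
split.
  apply: (@le_trans _ _ (\sum_(k < N)
    (((1 + eps^-1) * c)%:E * msq P (auto_state (sysA S) theta x0 k) +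
     (1 + eps)%:E * msq P (io_operator S theta (truncate N v) k)))).
    apply: lee_sum => k _.
    have mCx := mx_measurableM (mxC k) (mauto k).
    have := msq_leD P (a := 1 + eps^-1) (b := 1 + eps) (mout k) mCx (mio k).
    have p1 : (0 <= 1 + eps^-1)%R by rewrite addr_ge0// ltW.
    have p2 : (0 <= 1 + eps)%R by rewrite addr_ge0// ltW.
    move=> /(_ p1 p2) h; apply: (le_trans (h _)).
      by move=> w; rewrite (outputE S theta x0 v w (ltn_ord k)); exact: fro2D_le.
    apply: leeD => //; rewrite EFinM -muleA; apply: lee_wpmul2l => //.
    exact: msq_mulmx (mxC k) (mauto k) (ltW c0) (chain_ae Gg mtheta ch k Cc).
  rewrite big_split/= -!ge0_sume_distrr; try by move=> *; exact: msq_ge0.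
  have p1 : (0 <= (1 + eps^-1) * c)%R by rewrite mulr_ge0 ?addr_ge0// ltW.
  have p2 : (0 <= 1 + eps)%R by rewrite addr_ge0// ltW.
  apply: le_trans.
    by apply: leeD; apply: lee_wpmul2l;
      [rewrite lee_fin|exact: auto_sum|rewrite lee_fin|exact: io_sum].
  rewrite -!EFinM -EFinD lee_fin.
  have : (0 <= F * fro2 x0)%R by rewrite mulr_ge0// ltW.
  have : (0 <= L * fro2 x0)%R by rewrite mulr_ge0// ltW.
  by set q := (eps^-1)%R; set E := (\sum_(k < N) e k)%R; lra.
apply: (@le_trans _ _ (\sum_(k < N)
    (2%:E * msq P (auto_state (sysA S) theta x0 k) +
     2%:E * msq P (state S theta 0%R v k)))).
  apply: lee_sum => k _; apply: msq_leD => //.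
  by move=> w; rewrite state_superposition fro2D.
rewrite big_split/= -!ge0_sume_distrr; try by move=> *; exact: msq_ge0.
apply: le_trans.
  by apply: leeD; apply: lee_wpmul2l; [|exact: auto_sum| |exact: state_sum].
rewrite -!EFinM -EFinD lee_fin.
have : (0 <= (1 + eps^-1) * (c * F) * (fro2 x0 + \sum_(k < N) e k))%R.
  by apply: mulr_ge0; [exact: ltW (mulr_gt0 p0 cF0)|exact: addr_ge0].
have : (0 <= F * \sum_(k < N) e k)%R by rewrite mulr_ge0// ltW.
have : (0 <= L * fro2 x0)%R by rewrite mulr_ge0// ltW.
set X := ((1 + eps^-1) * (c * F))%R; set E := (\sum_(k < N) e k)%R.
by rewrite !mulrDl !mulrDr; lra.
Qed.


End gain.

(** * Small gain *)

(** The tail from [j] is at most [M * a j], so dropping its first term leaves at most the fraction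
    [1 - M^-1] of it: tails contract geometrically. Finite tails suffice throughout. *)
Lemma geometric_decay (R : realType) (a : nat -> R) (M : R) : 1 < M ->
  (forall k, 0 <= a k) ->
  (forall j N, \sum_(k < N) a (j + k)%N <= M * a j) ->
  forall j, a j <= M * (1 - M^-1) ^+ j * a 0%N.
Proof.
move=> M1 a0 aM; have M0 : 0 < M by lra.
have q0 : 0 <= 1 - M^-1 by rewrite subr_ge0 invf_le1 ?ltW.
have tail j N : \sum_(k < N) a (j + k)%N <= M * (1 - M^-1) ^+ j * a 0%N.
  elim: j N => [|j IH] N; first by rewrite mulr1.
  have := IH N.+1; have := aM j N.+1; rewrite big_ord_recl/= addn0.
  under eq_bigr do rewrite /bump leq0n add1n addnS -addSn.
  set s := \sum_(k < N) _ => aj le_s.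
  have {}aj : M^-1 * (a j + s) <= a j by rewrite mulrC ler_pdivrMr// mulrC.
  have : (1 - M^-1) * (a j + s) <= (1 - M^-1) * (M * (1 - M^-1) ^+ j * a 0%N).
    exact: ler_wpM2l.
  by rewrite exprS; lra.
by move=> j; have := tail j 1%N; rewrite big_ord1 addn0.
Qed.

Section decay.
Context d (T : measurableType d) (R : realType)
  (mu : {sigma_finite_measure set T -> \bar R})
  (G : R.-pker T ~> T) (g : T -> T -> R) (Gg : has_density mu G g).
Local Open Scope ereal_scope.
Hypothesis g_gt0 : {ae mu, forall l, 0 < \int[mu]_t (g t l)%:E}.

Lemma EMSS_of_summable n (A : T -> 'M[R]_(n, n)) (C : R) :
  mx_measurable A -> (0 < C)%R ->
  (forall d' (W : measurableType d') (P : probability W R) nu0 theta,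
    markov_chain mu G P nu0 theta -> forall x0 N,
    \sum_(k < N) msq P (auto_state A theta x0 k) <= (C * fro2 x0)%:E) ->
  EMSS mu G A.
Proof.
(* [M] dominates both [n * C], the constant after a restart, and [C], the constant at time 0; the
   last [+ 1] gives [1 < M], hence a positive rate. *)
move=> mA C0 sumC; pose M := ((n%:R + 1) * C + 1)%R.
have nC : (0 < (n%:R + 1) * C)%R by rewrite mulr_gt0// ltr_wpDl.
have M1 : (1 < M)%R by rewrite /M ltrDr.
have M0 : (0 < M)%R by exact: lt_trans M1.
exists M, (1 - M^-1)%R; split => //.
  by rewrite subr_gt0 invf_lt1// M1 gtrBl invr_gt0.
move=> d' W P nu0 theta ch x0 k.
rewrite expectation_euclid euclid_normE.
have mtheta k' : measurable_fun [set: W] (theta k') by case: ch.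
pose a k := fine (msq P (auto_state A theta x0 k)).
have aE j : msq P (auto_state A theta x0 j) = (a j)%:E.
  rewrite fineK// ge0_fin_numE ?msq_ge0//.
  apply: le_lt_trans (ltry (C * fro2 x0)).
  apply: le_trans (sumC _ _ _ _ _ ch x0 j.+1); rewrite big_ord_recr/= leeDr//.
  by apply: sume_ge0 => i _; exact: msq_ge0.
have a0E : a 0%N = fro2 x0 by rewrite /a /= msq_cst.
have a0 j : (0 <= a j)%R by rewrite fine_ge0// msq_ge0.
rewrite aE lee_fin -a0E; apply: (geometric_decay M1 a0) => j N.
rewrite -lee_fin -sumEFin.
(* At time 0 the state is deterministic and no earlier sigma-algebra exists to restart from. *)
case: j => [|j].
  under eq_bigr do rewrite add0n -aE.
  apply: (le_trans (sumC _ _ _ _ _ ch x0 N)); rewrite -a0E lee_fin.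
  rewrite ler_wpM2r// /M; have : (0 <= n%:R * C)%R by rewrite mulr_ge0// ltW.
  by rewrite mulrDl; lra.
have := restart Gg g_gt0 ch (r := index_iota 0 N) (c := C) (j := j)
  (M := auto_state A theta x0 j.+1) mA (ltW C0).
rewrite big_mkord aE -EFinM => h.
rewrite (@le_trans _ _ (n%:R * C * a j.+1)%:E)//; last first.
  by rewrite lee_fin ler_wpM2r// /M mulrDl; lra.
rewrite (eq_bigr (fun m : 'I_N => msq P (fun w => auto_state A (shifted j.+1 theta)
    (auto_state A theta x0 j.+1 w) m w))); last first.
  by move=> m _; rewrite -aE; apply: eq_msq => w; exact: auto_state_shift.
apply: h; last exact: past_mx_auto_state.
by move=> P' nu theta' ch' y0; rewrite big_mkord; exact: sumC ch' _ _.
Qed.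

End decay.

Lemma small_gain_bound (R : realFieldType) (a b A B g1 g2 : R) :
  0 <= g1 -> 0 <= g2 -> g1 * g2 < 1 -> a <= A + g1 * b -> b <= B + g2 * a ->
  a <= (A + g1 * B) / (1 - g1 * g2).
Proof.
move=> g10 g20 g12 aA bB; rewrite ler_pdivlMr ?subr_gt0//.
have : g1 * b <= g1 * (B + g2 * a) by exact: ler_wpM2l.
by lra.
Qed.

Lemma mule_lt1_exists (R : realType) (x y : \bar R) :
  (0 <= x < +oo)%E -> (0 <= y < +oo)%E -> (x * y < 1)%E ->
  exists s t : R, [/\ (x < s%:E)%E, (y < t%:E)%E & s * t < 1].
Proof.
case: x => [x||]//; case: y => [y||]// ; rewrite ?ltxx ?andbF//.
rewrite !lee_fin -EFinM lte_fin => /andP[x0 _] /andP[y0 _] xy.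
(* As [e <= 1], the product grows by at most [e * (x + y + 1)], half of the available gap. *)
pose e := Num.min 1 ((1 - x * y) / (2 * (x + y + 1))).
have D0 : 0 < 2 * (x + y + 1) by lra.
have e0 : 0 < e by rewrite lt_min ltr01 divr_gt0// subr_gt0.
have e1 : e <= 1 by rewrite ge_min lexx.
have eD : e * (2 * (x + y + 1)) <= 1 - x * y.
  by rewrite -ler_pdivlMr// ge_min lexx orbT.
exists (x + e), (y + e); rewrite !lte_fin !ltrDl; split => //.
have : e * e <= e by rewrite ler_piMr// ltW.
by lra.
Qed.

Lemma exists_slack (R : realFieldType) (p : R) : 0 <= p < 1 ->
  exists2 e : R, 0 < e & (1 + e) * (1 + e) * p < 1.
Proof.
(* The excess [(2 * e + e ^+ 2) * p] is then at most [(1 - p) / 2 + (1 - p) / 16]. *)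
move=> /andP[p0 p1]; exists ((1 - p) / 4); first by lra.
have q0 : 0 <= 1 - p by lra.
have pq : p * (1 - p) <= 1 - p by rewrite ler_piMl// ltW.
have : p * (1 - p) * (1 - p) <= 1 - p.
  by apply: le_trans pq; rewrite ler_piMr ?mulr_ge0//; lra.
by lra.
Qed.

(** * The closed loop as two driven systems *)

Section interconnection.
Context (T : Type) (R : realType) (n r : nat) (S1 S2 : mjls T R n r r).
Hypothesis D1 : forall l, sysD S1 l = 0.

Definition feedback (l : T) : 'M[R]_(n + n) :=
  block_mx (sysA S1 l + sysB S1 l *m sysD S2 l *m sysC S1 l) (sysB S1 l *m sysC S2 l)
           (sysB S2 l *m sysC S1 l)                          (sysA S2 l).

Context (W : Type) (theta : nat -> W -> T) (x0 : 'cV[R]_(n + n)).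

Let x := auto_state feedback theta x0.

Definition feedback_z1 k w : 'cV[R]_r := sysC S1 (theta k w) *m usubmx (x k w).

(** Without feedthrough in [S1], the first output depends on the state alone and the second is
    explicit in it: there is no algebraic loop to solve. *)
Definition feedback_z2 k w : 'cV[R]_r :=
  sysC S2 (theta k w) *m dsubmx (x k w) + sysD S2 (theta k w) *m feedback_z1 k w.

(** Each half of the closed-loop state is a trajectory of one open system driven by the output of
    the other, so [output_gain] applies to each system separately. *)
Lemma feedback_state k w :
  usubmx (x k w) = state S1 theta (usubmx x0) feedback_z2 k w /\
  dsubmx (x k w) = state S2 theta (dsubmx x0) feedback_z1 k w.
Proof.
elim: k => [//|k [IH1 IH2]] /=; rewrite -IH1 -IH2 -/(x k w).
have -> : x k.+1 w = feedback (theta k w) *m col_mx (usubmx (x k w)) (dsubmx (x k w)).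
  by rewrite vsubmxK.
rewrite /feedback mul_block_col col_mxKu col_mxKd.
rewrite /feedback_z2 /feedback_z1; split; last by rewrite addrC mulmxA.
by rewrite mulmxDl mulmxDr !mulmxA addrA addrAC.
Qed.

Lemma feedback_z1E k w :
  feedback_z1 k w = output S1 theta (usubmx x0) feedback_z2 k w.
Proof.
by rewrite /output D1 mul0mx addr0 -(feedback_state k w).1.
Qed.

Lemma feedback_z2E k w :
  feedback_z2 k w = output S2 theta (dsubmx x0) feedback_z1 k w.
Proof. by rewrite /output -(feedback_state k w).2. Qed.

End interconnection.

Section small_gain.
Context d (T : measurableType d) (R : realType)
  (mu : {sigma_finite_measure set T -> \bar R})
  (G : R.-pker T ~> T) (g : T -> T -> R) (Gg : has_density mu G g).
Local Open Scope ereal_scope.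
Hypothesis g_gt0 : {ae mu, forall l, 0 < \int[mu]_t (g t l)%:E}.
Variables (n r : nat) (S1 S2 : mjls T R n r r).
Hypothesis D1 : forall l, sysD S1 l = 0%R.
Hypotheses (mA1 : mx_measurable (sysA S1)) (mB1 : mx_measurable (sysB S1))
  (mC1 : mx_measurable (sysC S1)) (mD1 : mx_measurable (sysD S1)).
Hypotheses (mA2 : mx_measurable (sysA S2)) (mB2 : mx_measurable (sysB S2))
  (mC2 : mx_measurable (sysC S2)) (mD2 : mx_measurable (sysD S2)).
Hypotheses (bA1 : essbounded mu (sysA S1)) (bB1 : essbounded mu (sysB S1))
  (bC1 : essbounded mu (sysC S1)).
Hypotheses (bA2 : essbounded mu (sysA S2)) (bB2 : essbounded mu (sysB S2))
  (bC2 : essbounded mu (sysC S2)) (bD2 : essbounded mu (sysD S2)).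
Hypotheses (stable1 : EMSS mu G (sysA S1)) (stable2 : EMSS mu G (sysA S2)).

Lemma essbounded_feedback : essbounded mu (feedback S1 S2).
Proof.
apply: essbounded_block => //; try by apply: essboundedM.
by apply: essboundedD => //; apply: essboundedM => //; exact: essboundedM.
Qed.

Lemma mx_measurable_feedback : mx_measurable (feedback S1 S2).
Proof.
apply: mx_measurable_block => //; try by apply: mx_measurableM.
by apply: mx_measurableD => //; apply: mx_measurableM => //; exact: mx_measurableM.
Qed.

(** Small gain moves an unknown sum to the other side of an inequality, so the sum must be a real
    number beforehand. *)
Let auto_state_lty d' (W : measurableType d') (P : probability W R) nu0
    (theta : nat -> W -> T) x0 k : markov_chain mu G P nu0 theta ->
  msq P (auto_state (feedback S1 S2) theta x0 k) < +oo.
Proof.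
move=> ch; have mtheta k' : measurable_fun [set: W] (theta k') by case: ch.
have [c [c0 Ac]] := essbounded_feedback.
elim: k => [|k IH]; first by rewrite msq_cst ltry.
apply: le_lt_trans (msq_mulmx _ _ (ltW c0) (chain_ae Gg mtheta ch k Ac)) _.
- by apply: mx_measurable_comp => //; exact: mx_measurable_feedback.
- apply: (mx_measurable_auto_state k mx_measurable_feedback mtheta).
  exact: mx_measurable_cst.
- by rewrite lte_mul_pinfty// lee_fin ltW.
Qed.

Lemma feedback_summable (gamma1 gamma2 : R) :
  (0 < gamma1)%R -> (0 < gamma2)%R -> (gamma1 * gamma2 < 1)%R ->
  l2_gain mu G S1 gamma1 -> l2_gain mu G S2 gamma2 ->
  exists2 C : R, (0 < C)%R &
  forall d' (W : measurableType d') (P : probability W R) nu0 theta,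
    markov_chain mu G P nu0 theta -> forall x0 N,
    \sum_(k < N) msq P (auto_state (feedback S1 S2) theta x0 k) <= (C * fro2 x0)%:E.
Proof.
move=> gamma10 gamma20 gamma12 gain1 gain2.
have [|e e0 slack] := @exists_slack _ (gamma1 * gamma2)%R.
  by rewrite gamma12 mulr_ge0// ltW.
have [K1 K10 gainK1] :=
  output_gain Gg g_gt0 mA1 mB1 mC1 mD1 bB1 bC1 stable1 gamma10 e0 gain1.
have [K2 K20 gainK2] :=
  output_gain Gg g_gt0 mA2 mB2 mC2 mD2 bB2 bC2 stable2 gamma20 e0 gain2.
pose g1 := ((1 + e) * gamma1)%R; pose g2 := ((1 + e) * gamma2)%R.
have g10 : (0 < g1)%R by rewrite mulr_gt0// addr_gt0.
have g20 : (0 < g2)%R by rewrite mulr_gt0// addr_gt0.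
have g12 : (g1 * g2 < 1)%R by rewrite /g1 /g2; lra.
have g21 : (g2 * g1 < 1)%R by rewrite mulrC.
(* [E1] and [E2] arise by eliminating one output from the pair of inequalities [le1] and [le2]
   below. *)
pose E1 := ((K1 + g1 * K2) / (1 - g1 * g2))%R.
pose E2 := ((K2 + g2 * K1) / (1 - g2 * g1))%R.
have E10 : (0 < E1)%R by rewrite divr_gt0 ?subr_gt0// addr_gt0// mulr_gt0.
have E20 : (0 < E2)%R by rewrite divr_gt0 ?subr_gt0// addr_gt0// mulr_gt0.
exists (K1 * (1 + E2) + K2 * (1 + E1))%R.
  by rewrite addr_gt0// mulr_gt0// addr_gt0.
move=> d' W P nu0 theta ch x0 N.
have mtheta k : measurable_fun [set: W] (theta k) by case: ch.
have Fx k : past_mx theta k (auto_state (feedback S1 S2) theta x0 k).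
  case: k => [|k]; first exact: mx_measurable_cst.
  apply: (@past_mx_le _ _ _ _ _ _ k) => //.
  by apply: past_mx_auto_state; exact: mx_measurable_feedback.
have Fz1 k : past_mx theta k (feedback_z1 S1 S2 theta x0 k).
  apply: mx_measurableM; first exact: past_mx_comp.
  by apply: mx_measurable_usubmx; exact: Fx.
have Fz2 k : past_mx theta k (feedback_z2 S1 S2 theta x0 k).
  apply: mx_measurableD; apply: mx_measurableM.
  - exact: past_mx_comp.
  - by apply: mx_measurable_dsubmx; exact: Fx.
  - exact: past_mx_comp.
  - exact: Fz1.
have mx k := past_mx_measurable mtheta (Fx k).
have mxu k := mx_measurable_usubmx (mx k).
have mxd k := mx_measurable_dsubmx (mx k).
have mz1 k := past_mx_measurable mtheta (Fz1 k).
have mz2 k := past_mx_measurable mtheta (Fz2 k).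
have xu_lty k : msq P (fun w => usubmx (auto_state (feedback S1 S2) theta x0 k w)) < +oo.
  apply: le_lt_trans (auto_state_lty x0 k ch).
  apply: ge0_le_integral => //; try exact: measurable_fro2_EFin.
    by move=> w _; rewrite lee_fin fro2_ge0.
  by move=> w _; rewrite lee_fin [leRHS]fro2_submx lerDl fro2_ge0.
have xd_lty k : msq P (fun w => dsubmx (auto_state (feedback S1 S2) theta x0 k w)) < +oo.
  apply: le_lt_trans (auto_state_lty x0 k ch).
  apply: ge0_le_integral => //; try exact: measurable_fro2_EFin.
    by move=> w _; rewrite lee_fin fro2_ge0.
  by move=> w _; rewrite lee_fin [leRHS]fro2_submx lerDr fro2_ge0.
have mul_lty m p (A : T -> 'M[R]_(m, p)) (M : W -> 'cV[R]_p) k : mx_measurable A ->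
    essbounded mu A -> mx_measurable M -> msq P M < +oo ->
    msq P (fun w => A (theta k w) *m M w)%R < +oo.
  move=> mA [c [c0 Ac]] mM Moo.
  apply: le_lt_trans (msq_mulmx _ mM (ltW c0) (chain_ae Gg mtheta ch k Ac)) _.
    exact: mx_measurable_comp.
  by rewrite lte_mul_pinfty// lee_fin ltW.
have z1_lty k : msq P (feedback_z1 S1 S2 theta x0 k) < +oo by exact: mul_lty.
have z2_lty k : msq P (feedback_z2 S1 S2 theta x0 k) < +oo.
  have mCx : mx_measurable (fun w => sysC S2 (theta k w) *m
      dsubmx (auto_state (feedback S1 S2) theta x0 k w))%R.
    by apply: mx_measurableM => //; exact: mx_measurable_comp.
  have mDz : mx_measurable (fun w => sysD S2 (theta k w) *m
      feedback_z1 S1 S2 theta x0 k w)%R.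
    by apply: mx_measurableM => //; exact: mx_measurable_comp.
  have := msq_leD P (a := 2) (b := 2) (mz2 k) mCx mDz (ler0n _ _) (ler0n _ _)
    (fun w => fro2D _ _).
  move=> /le_lt_trans; apply.
  by rewrite lte_add_pinfty// lte_mul_pinfty//; exact: mul_lty.
pose e1 k := fine (msq P (feedback_z1 S1 S2 theta x0 k)).
pose e2 k := fine (msq P (feedback_z2 S1 S2 theta x0 k)).
have e1E k : msq P (feedback_z1 S1 S2 theta x0 k) = (e1 k)%:E.
  by rewrite fineK// ge0_fin_numE ?msq_ge0.
have e2E k : msq P (feedback_z2 S1 S2 theta x0 k) = (e2 k)%:E.
  by rewrite fineK// ge0_fin_numE ?msq_ge0.
have e1_le k : msq P (feedback_z1 S1 S2 theta x0 k) <= (e1 k)%:E by rewrite e1E.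
have e2_le k : msq P (feedback_z2 S1 S2 theta x0 k) <= (e2 k)%:E by rewrite e2E.
have [out1 st1] := gainK1 _ _ _ _ _ ch (usubmx x0) _ e2 Fz2 e2_le N.
have [out2 st2] := gainK2 _ _ _ _ _ ch (dsubmx x0) _ e1 Fz1 e1_le N.
set X := fro2 x0; have X0 : (0 <= X)%R by exact: fro2_ge0.
have Xu : (fro2 (usubmx x0) <= X)%R by rewrite [leRHS]fro2_submx lerDl fro2_ge0.
have Xd : (fro2 (dsubmx x0) <= X)%R by rewrite [leRHS]fro2_submx lerDr fro2_ge0.
have le1 : (\sum_(k < N) e1 k <= K1 * X + g1 * \sum_(k < N) e2 k)%R.
  rewrite -lee_fin -sumEFin.
  rewrite (eq_bigr (fun k : 'I_N => msq P (output S1 theta (usubmx x0)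
      (feedback_z2 S1 S2 theta x0) k))); last first.
    by move=> k _; rewrite -e1E; apply: eq_msq => w; exact: feedback_z1E.
  by apply: (le_trans out1); rewrite lee_fin lerD2r ler_wpM2l// ltW.
have le2 : (\sum_(k < N) e2 k <= K2 * X + g2 * \sum_(k < N) e1 k)%R.
  rewrite -lee_fin -sumEFin.
  rewrite (eq_bigr (fun k : 'I_N => msq P (output S2 theta (dsubmx x0)
      (feedback_z1 S1 S2 theta x0) k))); last first.
    by move=> k _; rewrite -e2E; apply: eq_msq => w; exact: feedback_z2E.
  by apply: (le_trans out2); rewrite lee_fin lerD2r ler_wpM2l// ltW.
have sum1 : (\sum_(k < N) e1 k <= E1 * X)%R.
  have := small_gain_bound (ltW g10) (ltW g20) g12 le1 le2.
  by rewrite mulrA -mulrDl mulrAC.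
have sum2 : (\sum_(k < N) e2 k <= E2 * X)%R.
  have := small_gain_bound (ltW g20) (ltW g10) g21 le2 le1.
  by rewrite mulrA -mulrDl mulrAC.
apply: (@le_trans _ _ (\sum_(k < N)
  (msq P (state S1 theta (usubmx x0) (feedback_z2 S1 S2 theta x0) k) +
   msq P (state S2 theta (dsubmx x0) (feedback_z1 S1 S2 theta x0) k)))).
  apply: lee_sum => k _.
  have -> : msq P (state S1 theta (usubmx x0) (feedback_z2 S1 S2 theta x0) k) =
      msq P (fun w => usubmx (auto_state (feedback S1 S2) theta x0 k w)).
    by apply: eq_msq => w; rewrite (feedback_state S1 S2 theta x0 k w).1.
  have -> : msq P (state S2 theta (dsubmx x0) (feedback_z1 S1 S2 theta x0) k) =
      msq P (fun w => dsubmx (auto_state (feedback S1 S2) theta x0 k w)).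
    by apply: eq_msq => w; rewrite (feedback_state S1 S2 theta x0 k w).2.
  have := msq_leD P (a := 1) (b := 1) (mx k) (mxu k) (mxd k) ler01 ler01.
  by rewrite !mul1e; apply => w; rewrite !mul1r -fro2_submx.
rewrite big_split/=; apply: (le_trans (leeD st1 st2)); rewrite -EFinD lee_fin mulrDl.
rewrite -!mulrA; apply: lerD; (apply: ler_wpM2l; first exact: ltW);
  by rewrite mulrDl mul1r; apply: lerD.
Qed.

End small_gain.

Theorem theorem1 (R : realType)
  (S : completeMetricType R) (sepS : separable_space S)
  (Theta : set S) (borelTheta : borel_set Theta) (l0 : Theta)
  (mu : {sigma_finite_measure set (borel_subspace l0) -> \bar R})
  (G : R.-pker (borel_subspace l0) ~> (borel_subspace l0))
  (g : borel_subspace l0 -> borel_subspace l0 -> R)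
  (Gg : has_density mu G g)
  (g_gt0 : {ae mu, forall l, (0 < \int[mu]_t (g t l)%:E)%E})
  (n r : nat)
  (A1 A2 : borel_subspace l0 -> 'M[R]_(n, n))
  (B1 B2 : borel_subspace l0 -> 'M[R]_(n, r))
  (C1 C2 : borel_subspace l0 -> 'M[R]_(r, n))
  (D2 : borel_subspace l0 -> 'M[R]_(r, r))
  (A1_bnd : Hinfty mu A1) (A2_bnd : Hinfty mu A2)
  (B1_bnd : Hinfty mu B1) (B2_bnd : Hinfty mu B2)
  (C1_bnd : Hinfty mu C1) (C2_bnd : Hinfty mu C2)
  (D2_bnd : Hinfty mu D2) :
  let S1 := Mjls A1 B1 C1 (fun=> 0) in
  let S2 := Mjls A2 B2 C2 D2 in
  internally_stable mu G S1 ->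
  internally_stable mu G S2 ->
  (io_norm mu G S1 * io_norm mu G S2 < 1)%E ->
  EMSS mu G (fun l : borel_subspace l0 =>
    block_mx (A1 l + B1 l *m D2 l *m C1 l) (B1 l *m C2 l)
             (B2 l *m C1 l)                (A2 l)).
Proof.
move=> S1 S2 stable1 stable2 norm12.
have [mA1 bA1] := Hinfty_essbounded A1_bnd.
have [mA2 bA2] := Hinfty_essbounded A2_bnd.
have [mB1 bB1] := Hinfty_essbounded B1_bnd.
have [mB2 bB2] := Hinfty_essbounded B2_bnd.
have [mC1 bC1] := Hinfty_essbounded C1_bnd.
have [mC2 bC2] := Hinfty_essbounded C2_bnd.
have [mD2 bD2] := Hinfty_essbounded D2_bnd.
have mD1 : mx_measurable (sysD S1) by exact: mx_measurable_cst.
have bD1 : essbounded mu (sysD S1).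
  by exists 1; split=> //; apply: nearW => l; rewrite fro2_0.
have fin1 := io_norm_lty (S := S1) Gg g_gt0 mA1 mB1 mC1 mD1 bB1 bC1 bD1 stable1.
have fin2 := io_norm_lty (S := S2) Gg g_gt0 mA2 mB2 mC2 mD2 bB2 bC2 bD2 stable2.
(* The infima need not be attained, so actual gains are taken below reals [s] and [t] that lie
   strictly above the norms and still have product below 1. *)
have [| |s [t [s1 t2 st]]] := mule_lt1_exists _ _ norm12.
- by rewrite fin1 io_norm_ge0.
- by rewrite fin2 io_norm_ge0.
have [gamma1 [gamma10 gs gain1]] :=
  io_norm_lt (S := S1) Gg g_gt0 mA1 mB1 mC1 mD1 bB1 bC1 bD1 stable1 s1.
have [gamma2 [gamma20 gt gain2]] :=
  io_norm_lt (S := S2) Gg g_gt0 mA2 mB2 mC2 mD2 bB2 bC2 bD2 stable2 t2.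
have gamma12 : gamma1 * gamma2 < 1.
  rewrite -(sqr_sqrtr (ltW gamma10)) -(sqr_sqrtr (ltW gamma20)) -exprMn.
  rewrite expr_lt1 ?mulr_ge0 ?sqrtr_ge0//; apply: le_lt_trans st.
  by apply: ler_pM; rewrite ?sqrtr_ge0// ltW.
have [C C0 sumC] := feedback_summable (S1 := S1) (S2 := S2) Gg g_gt0 (fun=> erefl)
  mA1 mB1 mC1 mD1 mA2 mB2 mC2 mD2 bA1 bB1 bC1 bA2 bB2 bC2 bD2 stable1 stable2
  gamma10 gamma20 gamma12 gain1 gain2.
apply: (EMSS_of_summable Gg g_gt0 _ C0 sumC).
exact: (mx_measurable_feedback (S1 := S1) (S2 := S2)).
Qed.
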